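(* Let $\mathcal{K}$ be a triangulation of a compact connected surface $\Gamma\subset\mathbb{R}^3$, let $\partial\mathcal{K}^c$ be the subcomplex of $\partial\mathcal{K}$ induced on a specified closed subset $\partial\Gamma^c\subset\partial\Gamma$, and let $\mathcal{G}^{\mathrm{ha}}$, $\mathcal{G}^{\mathrm{ho}}$, $\mathcal{G}^{\mathrm{co}}$ be the sets of $1$-cochains (global loops) computed by the ''handles'', ''holes'' and ''contacts'' algorithms described in the context, respectively. Then there is an isomorphism $$H^1(\mathcal{K},\partial\mathcal{K}^c;\mathbb{R})\;\cong\;\langle[\mathcal{G}^{\mathrm{ha}}]\rangle\oplus\langle[\mathcal{G}^{\mathrm{ho}}]\rangle\oplus\langle[\mathcal{G}^{\mathrm{co}}]\rangle,$$ where $\langle[\mathcal{G}]\rangle$ denotes the real linear span of the cohomology classes $[\mathbf{g}]$ of the elements $\mathbf{g}\in\mathcal{G}$.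
   Context: **Complexes.** $\Gamma\subset\mathbb{R}^3$ is a compact connected $2$-manifold with (possibly empty) boundary $\partial\Gamma$, possibly non-orientable. $\mathcal{K}=(V,E,F)$ is a triangulation of $\Gamma$ (a regular CW complex whose cells are simplices) with nodes $V$, edges $E$, faces $F$, each cell with a fixed orientation; $\iota(x,x')$ is the incidence number of an $m$-cell $x$ and an $(m-1)$-cell $x'$. $\partial\mathcal{K}$ is the subcomplex induced on $\partial\Gamma$, $E_\partial$ its set of edges, and $\partial\mathcal{K}^c\subset\partial\mathcal{K}$ the subcomplex induced on the closed subset $\partial\Gamma^c\subset\partial\Gamma$. $\partial\mathcal{K}_1,\dots,\partial\mathcal{K}_{N^{\mathrm{ho}}}$ are the connected components of $\partial\mathcal{K}$, and $\partial\mathcal{K}^{\mathrm{co}}_1,\dots,\partial\mathcal{K}^{\mathrm{co}}_{N^{\mathrm{co}}}$ are the connected components of $\partial\mathcal{K}^{\mathrm{co}}:=\partial\mathcal{K}\setminus\partial\mathcal{K}^c$. For an $m$-cochain $\mathbf{c}$ and an $m$-chain $c$, $\langle\mathbf{c},c\rangle$ denotes the value $\mathbf{c}(c)$. $\delta^m$ is the coboundary map. Relative cochains $C^m(\mathcal{K},\partial\mathcal{K}^c;\mathbb{R})$ are the $m$-cochains vanishing on all $m$-cells of $\partial\mathcal{K}^c$, and $H^1(\mathcal{K},\partial\mathcal{K}^c;\mathbb{R})$ is the corresponding cohomology. **Dual graph.** Each face $f$ has a dual node $D(f)$; $\tilde V=D(F)$. Each internal edge $e$, shared by two faces $f_e^{(1)},f_e^{(2)}$,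 has dual edge $D(e)=\{D(f_e^{(1)}),D(f_e^{(2)})\}$. Each boundary edge $e$, contained in the unique face $f_e$, has an additional boundary dual node $D_\partial(e)$ and dual edge $D(e)=\{D(f_e),D_\partial(e)\}$. $\tilde G=(\tilde V,\tilde E)$, with $\tilde E=D(E)$, is the dual graph. **Transport procedure.** Input: a path $\tilde p$ in $\tilde G$ with distinct dual nodes $D(f_1),\dots,D(f_l)$ ($l\ge1$) and distinct dual edges $D(e_1),\dots,D(e_{l-1})$, $D(e_i)=\{D(f_i),D(f_{i+1})\}$, and a pair of edges $(e,e')$ with $e\subset f_1$, $e'\subset f_l$. Put $e_0:=e$, $e_l:=e'$. Start with $\mathbf{g}=\mathbf{0}$, set $\langle\mathbf{g},e\rangle:=1$, and for $i=1,\dots,l$ successively set $\langle\mathbf{g},e_i\rangle:=-\frac{\iota(f_i,e_i)}{\iota(f_i,e_{i-1})}\langle\mathbf{g},e_{i-1}\rangle$. If $\langle\mathbf{g},e'\rangle=0$, return $\mathbf{0}$; otherwise return $\mathbf{g}$. **Handles algorithm (gives $\mathcal{G}^{\mathrm{ha}}$).** Choose a spanning tree on each connected component of $\partial\mathcal{K}$ and extend to a spanning tree $T=(V_T,E_T)$ of the whole $1$-skeleton of $\mathcal{K}$. Choose a spanning tree $\tilde T$ of the graph $\tilde G'=(\tilde V,\tilde E\setminus D(E_T))$. For each component $\partial\mathcal{K}_k$, take its unique edge $e\notin E_T$ and add $D(e)$ and $D_\partial(e)$ to $\tilde T$. Let $E_M:=\{e\in E: e\notin E_T,\ D(e)\notin\tilde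 E_{\tilde T}\}$, where $\tilde E_{\tilde T}$ is the edge set of $\tilde T$. For $e\in E_M$, let $\tilde p_e$ be the unique path in $\tilde T$ from $D(f_e^{(1)})$ to $D(f_e^{(2)})$ and let $\mathbf{g}_e^{\mathrm{ha}}$ be the output of the transport procedure on $\tilde p_e$ and $(e,e)$. Let $E_M^{\mathrm{II}}:=\{e\in E_M:\mathbf{g}_e^{\mathrm{ha}}=\mathbf{0}\}$. If $E_M^{\mathrm{II}}=\emptyset$, return $\mathcal{G}^{\mathrm{ha}}:=\{\mathbf{g}_e^{\mathrm{ha}}\}_{e\in E_M}$. Otherwise select $e^*\in E_M^{\mathrm{II}}$; for each $e\in E_M^{\mathrm{II}}\setminus\{e^*\}$ and $r=1,2$ let $\tilde p^{(r)}_{e,e^*}$ be the unique path in $\tilde T$ from $D(f_e^{(r)})$ to $D(f_{e^*}^{(r)})$, let $\mathbf{g}_e^{(r)}$ be the output of the transport procedure on it with the pair $(e,e^* )$, and redefine $\mathbf{g}_e^{\mathrm{ha}}$ by $\langle\mathbf{g}_e^{\mathrm{ha}},e'\rangle:=\langle\mathbf{g}_e^{(1)},e'\rangle$ if $e'\in\{e,e^*\}$ and $\langle\mathbf{g}_e^{\mathrm{ha}},e'\rangle:=\langle\mathbf{g}_e^{(1)},e'\rangle+\langle\mathbf{g}_e^{(2)},e'\rangle$ otherwise. Return $\mathcal{G}^{\mathrm{ha}}:=\{\mathbf{g}_e^{\mathrm{ha}}\}_{e\in E_M\setminus\{e^*\}}$. **Holes algorithm (gives $\mathcal{G}^{\mathrm{ho}}$;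 applied if $\partial\mathcal{K}\ne\emptyset$, otherwise $\mathcal{G}^{\mathrm{ho}}=\emptyset$).** For $k=1,\dots,N^{\mathrm{ho}}-1$ let $\mathbf{c}_k^{\mathrm{ho}}$ be the $0$-cochain equal to $1$ on nodes of $\partial\mathcal{K}_k$ and $0$ on all other nodes, and $\mathbf{g}_k^{\mathrm{ho}}:=\delta^0\mathbf{c}_k^{\mathrm{ho}}$. Return $\mathcal{G}^{\mathrm{ho}}:=\{\mathbf{g}_1^{\mathrm{ho}},\dots,\mathbf{g}_{N^{\mathrm{ho}}-1}^{\mathrm{ho}}\}$. **Contacts algorithm (gives $\mathcal{G}^{\mathrm{co}}$; applied if $\partial\mathcal{K}\neq\emptyset$ and $\partial\mathcal{K}^{\mathrm{co}}\ne\emptyset$, otherwise $\mathcal{G}^{\mathrm{co}}=\emptyset$).** Use $\tilde T$ and $E_M^{\mathrm{II}}$ from the handles algorithm. Select an edge $\hat e$ of $\partial\mathcal{K}^{\mathrm{co}}_{N^{\mathrm{co}}}$, with unique incident face $f_{\hat e}$. For $j=1,\dots,N^{\mathrm{co}}-1$, select an edge $e_j$ of $\partial\mathcal{K}^{\mathrm{co}}_j$ with unique incident face $f_{e_j}$, and let $\mathbf{g}_j^{\mathrm{co}}$ be the output of the transport procedure on the unique path in $\tilde T$ from $D(f_{e_j})$ to $D(f_{\hat e})$ with the pair $(e_j,\hat e)$. If $E_M^{\mathrm{II}}=\emptyset$, return $\mathcal{G}^{\mathrm{co}}:=\{\mathbf{g}_1^{\mathrm{co}},\dots,\mathbf{g}^{\mathrm{co}}_{N^{\mathrm{co}}-1}\}$.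 Otherwise select $e^*\in E_M^{\mathrm{II}}$; for $r=1,2$ let $\mathbf{g}^{(r)}$ be the output of the transport procedure on the unique path in $\tilde T$ from $D(f_{\hat e})$ to $D(f_{e^*}^{(r)})$ with the pair $(\hat e,e^* )$; define $\mathbf{g}^{\mathrm{co}}_{N^{\mathrm{co}}}$ by $\langle\mathbf{g}^{\mathrm{co}}_{N^{\mathrm{co}}},e'\rangle:=\langle\mathbf{g}^{(1)},e'\rangle$ if $e'=e^*$ and $:=\langle\mathbf{g}^{(1)},e'\rangle+\langle\mathbf{g}^{(2)},e'\rangle$ otherwise; return $\mathcal{G}^{\mathrm{co}}:=\{\mathbf{g}_1^{\mathrm{co}},\dots,\mathbf{g}^{\mathrm{co}}_{N^{\mathrm{co}}}\}$. The classes $[\mathbf{g}]$ in the claim are classes in $H^1(\mathcal{K},\partial\mathcal{K}^c;\mathbb{R})$.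
   Formalization: In the transport procedure with e = e', the test ⟨g,e'⟩ = 0 never fires, as all values are ±1 (on a Möbius band the output is then no cocycle); the formal statement instead returns 0 when the value arriving back at e differs from the initial 1. *)

(* Defs.v *)
From HB Require Import structures.
From mathcomp Require Import all_boot all_order all_algebra.
From mathcomp Require Import all_classical all_reals all_analysis.
Import numFieldNormedType.Exports.
Import Order.TTheory GRing.Theory Num.Theory.

Set Implicit Arguments.
Unset Strict Implicit.
Unset Printing Implicit Defensive.

Local Open Scope ring_scope.

(* MathComp has no quotient vector space.  V / U is realised on a complement
   of U, [qcls U] being the projection along U; [qcls_ker] and [qcls_surj]
   characterise it up to a unique isomorphism. *)
Definition quot (R : fieldType) (vT : vectType R) (U : {vspace vT}) :=
  subvs_of (U^C)%VS.

Definition qcls (R : fieldType) (vT : vectType R) (U : {vspace vT}) :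
    'Hom(vT, subvs_of (U^C)%VS) :=
  (linfun (vsproj (U^C)%VS) \o daddv_pi (U^C)%VS U)%VF.

Lemma qcls_ker (R : fieldType) (vT : vectType R) (U : {vspace vT}) (v : vT) :
  (qcls U v == 0) = (v \in U).
Proof.
have dxU : (U :&: U^C = 0)%VS by exact: capv_compl.
have dxC : (U^C :&: U = 0)%VS by rewrite capvC.
have vUC : v \in (U + U^C)%VS by rewrite addv_complf memvf.
have eqv : daddv_pi U U^C v + daddv_pi U^C U v = v by exact: daddv_pi_add.
rewrite lfunE /= lfunE /= -(inj_eq val_inj) /= vsprojK ?memv_pi //.
apply/eqP/idP => [p0|Uv].
  by rewrite -eqv p0 addr0 memv_pi.
by move: eqv; rewrite (daddv_pi_id dxU Uv) -[RHS]addr0 => /addrI.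
Qed.

Lemma qcls_surj (R : fieldType) (vT : vectType R) (U : {vspace vT})
    (q : quot U) : exists v, qcls U v = q.
Proof.
have dxC : (U^C :&: U = 0)%VS by rewrite capvC capv_compl.
exists (vsval q); apply: val_inj.
rewrite /= lfunE /= lfunE /= vsprojK ?memv_pi //.
by rewrite (daddv_pi_id dxC) ?subvsP.
Qed.

(* An edge of a graph is the set of its two end points. *)
Definition gadj (N : finType) (S : {set {set N}}) : rel N :=
  fun x y => (x != y) && ([set x; y] \in S).

Definition graph_connected (N : finType) (A : {set N}) (S : {set {set N}}) :=
  A != finset.set0 /\ {in A &, forall x y, connect (gadj S) x y}.

Definition is_graph (N : finType) (A : {set N}) (S : {set {set N}}) :=
  forall s, s \in S -> s \subset A /\ #|s| = 2.

Definition acyclic (N : finType) (S : {set {set N}}) :=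
  forall c : seq N, ucycle (gadj S) c -> (size c <= 2)%N.

Definition is_tree (N : finType) (A : {set N}) (S : {set {set N}}) :=
  [/\ is_graph A S, graph_connected A S & acyclic S].

Definition spanning_tree (N : finType) (A : {set N}) (G S : {set {set N}}) :=
  S \subset G /\ is_tree A S.

(* p lists all the nodes of the path, end points included. *)
Definition simple_path (N : finType) (S : {set {set N}}) (x y : N)
    (p : seq N) : Prop :=
  exists q, [/\ p = x :: q, path (gadj S) x q, last x q = y & uniq (x :: q)].

Definition tree_path (N : finType) (S : {set {set N}}) (x y : N) : seq N :=
  xget [::] (simple_path S x y).

(* A simplex is its nonempty set of nodes; every element of V is a node. *)
Definition simplicial_complex (V : finType) (K : {set {set V}}) :=
  [/\ finset.set0 \notin K,
      forall s t : {set V}, s \in K -> t \subset s -> t != finset.set0 ->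
        t \in K
    & forall v, [set v]%SET \in K].

Definition cells (V : finType) (K : {set {set V}}) (m : nat) : {set {set V}} :=
  [set s in K | #|s| == m.+1]%SET.

Definition nodes (V : finType) (L : {set {set V}}) : {set V} :=
  [set v | [set v]%SET \in L]%SET.

Notation edges K := (cells K 1).
Notation faces K := (cells K 2).

Definition cofaces (V : finType) (K : {set {set V}}) (e : {set V}) :
    {set {set V}} :=
  [set f in faces K | e \subset f]%SET.

Definition link_nodes (V : finType) (K : {set {set V}}) (v : V) : {set V} :=
  [set w | (w != v) && ([set v; w]%SET \in K)]%SET.

Definition link_edges (V : finType) (K : {set {set V}}) (v : V) :
    {set {set V}} :=
  [set e in edges K | (v \notin e) && (v |: e \in K)]%SET.

(* K triangulates a compact connected 2-manifold with (possibly empty) boundary: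
   the degree bound on edges turns connectedness of a link into
   "the link is a path or a cycle".  Orientability is not assumed. *)
Definition surface_complex (V : finType) (K : {set {set V}}) :=
  [/\ simplicial_complex K,
      forall s, s \in K -> exists2 f, f \in faces K & s \subset f,
      forall e, e \in edges K -> (#|cofaces K e| <= 2)%N,
      forall v, graph_connected (link_nodes K v) (link_edges K v)
    & graph_connected [set: V]%SET (edges K)].

Definition bd_edges (V : finType) (K : {set {set V}}) : {set {set V}} :=
  [set e in edges K | #|cofaces K e| == 1%N]%SET.

Definition bd (V : finType) (K : {set {set V}}) : {set {set V}} :=
  [set s in K | [exists e in bd_edges K, s \subset e]]%SET.

(* Connected components of the union of the open cells of L; L need not be
   closed under taking faces. *)
Definition cell_adj (V : finType) (L : {set {set V}}) : rel {set V} :=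
  fun s t => [&& s \in L, t \in L & (s \proper t) || (t \proper s)].

Definition components (V : finType) (L : {set {set V}}) :
    {set {set {set V}}} :=
  equivalence_partition (connect (cell_adj L)) L.

(* Barycentric coordinates: the coordinate of node v is the entry
   [enum_rank v] of the row vector. *)
Definition closed_simplex (R : realType) (V : finType) (s : {set V}) :
    set 'rV[R]_#|V| :=
  [set x | [/\ forall v, 0 <= x 0 (enum_rank v),
               \sum_v x 0 (enum_rank v) = 1
             & forall v, v \notin s -> x 0 (enum_rank v) = 0]]%classic.

Arguments closed_simplex R {V} s _.

Definition polyhedron (R : realType) (V : finType) (K : {set {set V}}) :
    set 'rV[R]_#|V| :=
  [set x | exists2 s, s \in K & closed_simplex R s x]%classic.

Arguments polyhedron R {V} K _.

(* The polyhedron being compact, phi is a homeomorphism onto Gamma. *)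
Definition triangulates (R : realType) (V : finType) (K : {set {set V}})
    (phi : 'rV[R]_#|V| -> 'rV[R]_3) (Gamma : set 'rV[R]_3) :=
  [/\ surface_complex K,
      {within polyhedron R K, continuous phi},
      {in polyhedron R K &, injective phi}
    & phi @` polyhedron R K = Gamma]%classic.

Definition surface_boundary (R : realType) (V : finType) (K : {set {set V}})
    (phi : 'rV[R]_#|V| -> 'rV[R]_3) : set 'rV[R]_3 :=
  (phi @` polyhedron R (bd K))%classic.

Definition induced_on (R : realType) (V : finType)
    (phi : 'rV[R]_#|V| -> 'rV[R]_3) (L : {set {set V}}) (X : set 'rV[R]_3) :
    {set {set V}} :=
  [set s in L | `[< (phi @` closed_simplex R s `<=` X)%classic >]]%SET.

(* An orientation is an ordering of the nodes of each cell: the edge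
   [:: a; b] runs from a to b, the face [:: a; b; c] cycles a -> b -> c -> a,
   and nodes are positively oriented. *)
Definition orientation (V : finType) (K : {set {set V}})
    (o : {set V} -> seq V) :=
  forall s, s \in K -> perm_eq (o s) (enum s).

Definition incidence (R : realType) (V : finType) (o : {set V} -> seq V)
    (x y : {set V}) : R :=
  match o x, o y with
  | [:: a; b], [:: v] => if v == b then 1 else if v == a then - 1 else 0
  | [:: a; b; c], [:: u; w] =>
      if (u, w) \in [:: (a, b); (b, c); (c, a)] then 1
      else if (w, u) \in [:: (a, b); (b, c); (c, a)] then - 1 else 0
  | _, _ => 0
  end.

(* An m-cochain is extended by 0 to all sets of nodes, so that cochains of all
   degrees live in one space. *)
Notation cochain R V := {ffun {set V} -> R^o}.

Definition coboundary_fun (R : realType) (V : finType) (K : {set {set V}})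
    (o : {set V} -> seq V) (c : cochain R V) : cochain R V :=
  [ffun x => if x \in K then \sum_(y in K) incidence R o x y * c y else 0].

Lemma coboundary_fun_is_linear (R : realType) (V : finType)
    (K : {set {set V}}) (o : {set V} -> seq V) :
  linear (@coboundary_fun R V K o).
Proof.
move=> a c d; apply/ffunP => x; rewrite !ffunE.
case: ifP => _; last by rewrite scaler0 addr0.
rewrite scaler_sumr -big_split /=; apply: eq_bigr => y _.
by rewrite !ffunE mulrDr; congr (_ + _); rewrite /GRing.scale /= mulrCA.
Qed.

HB.instance Definition _ (R : realType) (V : finType)
    (K : {set {set V}}) (o : {set V} -> seq V) :=
  GRing.isLinear.Build R (cochain R V) (cochain R V) _ (@coboundary_fun R V K o)
    (@coboundary_fun_is_linear R V K o).

Definition coboundary (R : realType) (V : finType) (K : {set {set V}})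
    (o : {set V} -> seq V) : 'Hom(cochain R V, cochain R V) :=
  linfun (@coboundary_fun R V K o).

Definition elementary (R : realType) (V : finType) (s : {set V}) :
    cochain R V :=
  [ffun t => (t == s)%:R].

(* C^m(K, L); see [rel_cochainsP]. *)
Definition rel_cochains (R : realType) (V : finType) (K L : {set {set V}})
    (m : nat) : {vspace cochain R V} :=
  <<[seq elementary R s | s <- enum (cells K m :\: L)%SET]>>%VS.

Lemma rel_cochainsP (R : realType) (V : finType) (K L : {set {set V}})
    (m : nat) (c : cochain R V) :
  reflect (forall s, s \notin (cells K m :\: L)%SET -> c s = 0)
          (c \in rel_cochains R K L m).
Proof.
set A := (cells K m :\: L)%SET; apply: (iffP idP) => [cC s sA|c0].
  have := coord_span cC => ->; rewrite sum_ffunE big1 // => i _.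
  have lti : (i < size (enum A))%N.
    by rewrite -cardE.
  rewrite ffunE (nth_map finset.set0) // ffunE (_ : s == _ = false) ?scaler0 //.
  apply: contraNF sA => /eqP ->.
  by have := mem_nth finset.set0 lti; rewrite mem_enum.
have -> : c = \sum_(s in A) c s *: elementary R s.
  apply/ffunP => t; rewrite sum_ffunE; have [tA|tA] := boolP (t \in A).
    rewrite (bigD1 t) //= big1 ?addr0.
      by rewrite !ffunE eqxx /GRing.scale /= mulr1.
    by move=> s /andP[_ st]; rewrite !ffunE eq_sym (negbTE st) scaler0.
  rewrite c0 // big1 // => s sA; rewrite !ffunE.
  by rewrite (_ : t == s = false) ?scaler0 //; apply: contraNF tA => /eqP ->.
apply: memv_suml => s sA; apply: memvZ; apply: memv_span.
by apply: map_f; rewrite mem_enum.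
Qed.

Definition rel_cocycles1 (R : realType) (V : finType) (K L : {set {set V}})
    (o : {set V} -> seq V) : {vspace cochain R V} :=
  (rel_cochains R K L 1 :&: lker (coboundary R K o))%VS.

Definition rel_coboundaries1 (R : realType) (V : finType)
    (K L : {set {set V}}) (o : {set V} -> seq V) : {vspace cochain R V} :=
  (coboundary R K o @: rel_cochains R K L 0)%VS.

(* The ambient space: all cochains modulo B^1(K, L). *)
Definition cochains_mod_B1 (R : realType) (V : finType)
    (K L : {set {set V}}) (o : {set V} -> seq V) : vectType R :=
  quot (rel_coboundaries1 R K L o).

Definition cohom_class (R : realType) (V : finType) (K L : {set {set V}})
    (o : {set V} -> seq V) :
    'Hom(cochain R V, cochains_mod_B1 R K L o) :=
  qcls (rel_coboundaries1 R K L o).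

(* H^1(K, L; R) = Z^1 / B^1. *)
Definition rel_H1 (R : realType) (V : finType) (K L : {set {set V}})
    (o : {set V} -> seq V) : {vspace cochains_mod_B1 R K L o} :=
  (cohom_class R K L o @: rel_cocycles1 R K L o)%VS.

Definition span_classes (R : realType) (V : finType) (K L : {set {set V}})
    (o : {set V} -> seq V) (G : seq (cochain R V)) :
    {vspace cochains_mod_B1 R K L o} :=
  <<[seq cohom_class R K L o g | g <- G]>>%VS.

(* Dual nodes are encoded by cells: D(f) is the face f itself, and the boundary
   dual node of a boundary edge e is e itself. *)
Definition dual_edge (V : finType) (K : {set {set V}}) (e : {set V}) :
    {set {set V}} :=
  (cofaces K e :|: (if e \in bd_edges K then [set e] else finset.set0))%SET.

Definition assign (R : realType) (V : finType) (g : cochain R V)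
    (e : {set V}) (a : R) : cochain R V :=
  [ffun x => if x == e then a else g x].

(* [fs] lists the faces still to be crossed, entering through e; the edge dual
   to the dual edge {D(f), D(f')} is f :&: f'. *)
Fixpoint transport_along (R : realType) (V : finType) (o : {set V} -> seq V)
    (g : cochain R V) (e : {set V}) (fs : seq {set V}) (e' : {set V}) :
    cochain R V :=
  if fs is f :: fs' then
    let e1 := if fs' is f' :: _ then (f :&: f')%SET else e' in
    transport_along o
      (assign g e1 (- (incidence R o f e1 / incidence R o f e) * g e))
      e1 fs' e'
  else g.

(* When e' = e, the last assignment overwrites the initial value 1 by 1 or -1;
   the value -1 (the path is orientation reversing) contradicts the value
   prescribed at the start and is treated as a failure. *)
Definition transport (R : realType) (V : finType) (o : {set V} -> seq V)
    (fs : seq {set V}) (e e' : {set V}) : cochain R V :=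
  let g := transport_along o (assign 0 e 1) e fs e' in
  if (g e' == 0) || ((e == e') && (g e' != 1)) then 0 else g.

(* The tree ET of the 1-skeleton extends a spanning tree of each component of
   the boundary. *)
Definition handles_tree (V : finType) (K ET : {set {set V}}) :=
  spanning_tree [set: V]%SET (edges K) ET /\
  (forall C, C \in components (bd K) ->
     exists2 S : {set {set V}}, S \subset ET & spanning_tree (nodes C) (edges C) S).

(* T0 is the spanning tree on the dual nodes D(F); in the graph with node set
   D(F), a dual edge with a boundary dual node is no edge. *)
Definition handles_dual_tree (V : finType) (K ET : {set {set V}})
    (Tt : {set {set {set V}}}) :=
  exists2 T0,
    spanning_tree (faces K) [set dual_edge K e | e in edges K :\: ET]%SET T0
  & Tt = (T0 :|: [set dual_edge K e | e in bd_edges K :\: ET])%SET.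

(* f1 e and f2 e are the two faces of the internal edge e. *)
Definition face_labels (V : finType) (K : {set {set V}})
    (f1 f2 : {set V} -> {set V}) :=
  forall e, e \in edges K -> e \notin bd_edges K ->
    cofaces K e = [set f1 e; f2 e]%SET.

Definition EM (V : finType) (K ET : {set {set V}})
    (Tt : {set {set {set V}}}) : {set {set V}} :=
  [set e in edges K | (e \notin ET) && (dual_edge K e \notin Tt)]%SET.

Definition handle_loop (R : realType) (V : finType) (o : {set V} -> seq V)
    (Tt : {set {set {set V}}}) (f1 f2 : {set V} -> {set V}) (e : {set V}) :
    cochain R V :=
  transport R o (tree_path Tt (f1 e) (f2 e)) e e.

Definition EMII (R : realType) (V : finType) (K : {set {set V}})
    (o : {set V} -> seq V) (ET : {set {set V}}) (Tt : {set {set {set V}}})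
    (f1 f2 : {set V} -> {set V}) : {set {set V}} :=
  [set e in EM K ET Tt | handle_loop R o Tt f1 f2 e == 0]%SET.

Definition paired_handle_loop (R : realType) (V : finType)
    (o : {set V} -> seq V) (Tt : {set {set {set V}}})
    (f1 f2 : {set V} -> {set V}) (es e : {set V}) : cochain R V :=
  let g1 := transport R o (tree_path Tt (f1 e) (f1 es)) e es in
  let g2 := transport R o (tree_path Tt (f2 e) (f2 es)) e es in
  [ffun x => if x \in [set e; es]%SET then g1 x else g1 x + g2 x].

Definition Gha (R : realType) (V : finType) (K : {set {set V}})
    (o : {set V} -> seq V) (ET : {set {set V}}) (Tt : {set {set {set V}}})
    (f1 f2 : {set V} -> {set V}) (es : {set V}) : seq (cochain R V) :=
  let II := EMII R K o ET Tt f1 f2 in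
  if II == finset.set0 then
    [seq handle_loop R o Tt f1 f2 e | e <- enum (EM K ET Tt)]
  else
    [seq (if e \in II then paired_handle_loop R o Tt f1 f2 es e
          else handle_loop R o Tt f1 f2 e) | e <- enum (EM K ET Tt :\ es)%SET].

Definition numbering (V : finType) (L : {set {set V}})
    (Cs : seq {set {set V}}) :=
  uniq Cs /\ Cs =i components L.

Definition node_indicator (R : realType) (V : finType) (C : {set {set V}}) :
    cochain R V :=
  [ffun s => (s \in cells C 0)%:R].

Definition Gho (R : realType) (V : finType) (K : {set {set V}})
    (o : {set V} -> seq V) (Cs : seq {set {set V}}) : seq (cochain R V) :=
  [seq coboundary R K o (node_indicator R C) | C <- take (size Cs).-1 Cs].

Definition incident_face (V : finType) (K : {set {set V}}) (e : {set V}) :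
    {set V} :=
  odflt finset.set0 [pick f in cofaces K e].

Definition contact_edges (V : finType) (Cs : seq {set {set V}})
    (sel : {set {set V}} -> {set V}) :=
  forall C, C \in Cs -> sel C \in edges C.

Definition contact_loop (R : realType) (V : finType) (K : {set {set V}})
    (o : {set V} -> seq V) (Tt : {set {set {set V}}}) (eh ej : {set V}) :
    cochain R V :=
  transport R o (tree_path Tt (incident_face K ej) (incident_face K eh)) ej eh.

Definition twisted_contact_loop (R : realType) (V : finType)
    (K : {set {set V}}) (o : {set V} -> seq V) (Tt : {set {set {set V}}})
    (f1 f2 : {set V} -> {set V}) (es eh : {set V}) : cochain R V :=
  let g1 := transport R o (tree_path Tt (incident_face K eh) (f1 es)) eh es in
  let g2 := transport R o (tree_path Tt (incident_face K eh) (f2 es)) eh es in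
  [ffun x => if x == es then g1 x else g1 x + g2 x].

Definition Gco (R : realType) (V : finType) (K : {set {set V}})
    (o : {set V} -> seq V) (ET : {set {set V}}) (Tt : {set {set {set V}}})
    (f1 f2 : {set V} -> {set V}) (Cs : seq {set {set V}})
    (sel : {set {set V}} -> {set V}) (es : {set V}) : seq (cochain R V) :=
  if Cs is [::] then [::] else
  let eh := sel (last finset.set0 Cs) in
  let G := [seq contact_loop R K o Tt eh (sel C) | C <- take (size Cs).-1 Cs] in
  if EMII R K o ET Tt f1 f2 == finset.set0 then G
  else rcons G (twisted_contact_loop R K o Tt f1 f2 es eh).

(* Main.v *)
(* Orient the faces by signs omega that are coherent along the dual tree, and
   write s(f, e) = omega(f) iota(f, e).  Crossing the tree, the transport
   procedure carries a constant flux s(f, e) g(e), so each of its outputs is an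
   explicit combination of the two end edges and of a cochain on tree edges
   whose coboundary, weighted by omega, is [f_1] - [f_l].  An edge e of E_M is
   in E_M^II exactly when s(f1, e) = s(f2, e), i.e. when its loop reverses the
   orientation.
   Generation.  A node of the boundary lies on 0 or 2 boundary edges.  Hence,
   modulo relative coboundaries, a cocycle is supported on the boundary by the
   selected edges, where contact loops kill it; if E_M^II is empty, the last
   value vanishes by Stokes, because omega is then coherent everywhere.  Then a
   potential along the spanning tree kills the values on that tree; it is
   constant on each boundary component, hence is a combination of indicators of
   components up to a cochain vanishing on the boundary.  Handle loops then
   leave a cocycle supported on the dual tree, which is 0.
   Directness.  If h + g + c = d b, then c = d b on the boundary and a parity
   count of boundary degrees gives c = 0; so h is the coboundary of a cochain
   and vanishes on a spanning tree, whence h = 0. *)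
From HB Require Import structures.
Require Import Defs.
From mathcomp Require Import all_boot all_order all_algebra.
From mathcomp Require Import all_classical all_reals all_analysis.
From mathcomp Require Import ring zify.
Import numFieldNormedType.Exports.

Set Implicit Arguments.
Unset Strict Implicit.
Unset Printing Implicit Defensive.

Local Open Scope ring_scope.

(** * Finite graphs: growth along edges, trees and potentials *)

Section Graphs.
Import boot.fintype boot.finset.
Variable N : finType.
Implicit Types (A B : {set N}) (S : {set {set N}}).

Lemma gadj_sym S : symmetric (gadj S).
Proof. by move=> x y; rewrite /gadj eq_sym setUC. Qed.

Lemma gadj_subset S S' x y : S \subset S' -> gadj S x y -> gadj S' x y.
Proof. by move=> /subsetP sub /andP[xy] /sub xyS; rewrite /gadj xy. Qed.

Lemma gadj_graph A S x y :
  is_graph A S -> gadj S x y -> (x \in A) /\ (y \in A).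
Proof.
by move=> gS /andP[_ /gS[/subsetP sA _]]; rewrite !sA // !inE eqxx ?orbT.
Qed.

Lemma connect_cross (e : rel N) B x y :
  connect e x y -> x \in B -> y \notin B ->
  exists u v, [/\ u \in B, v \notin B & e u v].
Proof.
case/connectP => p; elim: p x => [|z p IH] x /=; first by move=> _ -> ->.
move=> /andP[xz zp] yl xB yB; have [zB|zB] := boolP (z \in B).
  by apply: IH zp yl zB yB.
by exists x, z.
Qed.

(** By connectedness some edge leaves any proper subset of A that contains r, so adding one vertex
    at a time to [[set r]] exhausts A. *)
Lemma graph_ind A S (P : {set N} -> Prop) r :
  is_graph A S -> graph_connected A S -> r \in A -> P [set r] ->
  (forall B x y, B \subset A -> P B -> x \in B -> y \in A -> y \notin B ->
     gadj S x y -> P (y |: B)) ->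
  P A.
Proof.
move=> gS [_ conS] rA P1 Pstep.
suff H n B : r \in B -> B \subset A -> P B -> #|A :\: B| = n -> P A.
  by apply: (H _ [set r]) => //; rewrite ?set11 ?sub1set.
elim: n B => [|n IH] B rB BA PB cardAB.
  suff <- : B = A by [].
  apply/eqP; rewrite eqEsubset BA /= -setD_eq0.
  by rewrite -cards_eq0 cardAB.
have [y0] : exists y, y \in A :\: B.
  by apply/set0Pn; rewrite -card_gt0 cardAB.
rewrite inE => /andP[y0B y0A].
have [x [y [xB yB xy]]] := connect_cross (conS _ _ rA y0A) rB y0B.
have yA := (gadj_graph gS xy).2.
apply: (IH (y |: B)).
- by rewrite inE rB orbT.
- by rewrite subUset sub1set yA.
- exact: (Pstep B x y).
- move: cardAB; rewrite (cardsD1 y) !inE yB yA /= add1n => -[<-].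
  by apply: eq_card => z; rewrite !inE negb_or andbA.
Qed.

(** Each vertex added to a growing set B brings the edge that joins it to B, which is new because it
    is not contained in B. *)
Lemma connected_card A S :
  is_graph A S -> graph_connected A S -> (#|A| <= #|S|.+1)%N.
Proof.
move=> gS conS; have [/set0Pn[r rA] _] := conS.
suff: (#|A| <= #|[set s in S | s \subset A]|.+1)%N.
  move=> /leq_trans; apply; rewrite ltnS; apply: subset_leq_card.
  by apply/subsetP => s; rewrite inE => /andP[].
apply: (graph_ind (P := fun B => (#|B| <= #|[set s in S | s \subset B]|.+1)%N)
  gS conS rA); first by rewrite cards1.
move=> B x y BA cB xB yA yB /andP[xy xyS].
rewrite cardsU1 yB add1n; apply: (leq_ltn_trans cB); rewrite ltnS.
rewrite -[leqLHS]add1n -(cards1 [set x; y]) -cardsUI.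
rewrite [X in (_ + X)%N](_ : _ = 0) ?addn0; last first.
  apply/eqP; rewrite cards_eq0 -subset0; apply/subsetP => s; rewrite !inE.
  by case/and3P=> /eqP -> _ /subsetP /(_ y);
    rewrite !inE eqxx orbT (negbTE yB) => /(_ isT).
apply: subset_leq_card; apply/subsetP => s; rewrite !inE.
case/orP => [/eqP ->|/andP[-> sB] /=]; last first.
  by apply: (subset_trans sB); apply/subsetP => z; rewrite !inE orbC => ->.
by rewrite xyS subUset !sub1set !inE eqxx xB orbT.
Qed.

Lemma connected_const A S (X : Type) (a : N -> X) :
  graph_connected A S -> (forall x y, gadj S x y -> a x = a y) ->
  {in A &, forall x y, a x = a y}.
Proof.
move=> [_ conS] aS x y xA yA; case/connectP: (conS x y xA yA) => p.
elim: p x {xA} => [|z p IH] x /=; first by move=> _ ->.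
by move=> /andP[/aS -> zp] yl; apply: IH.
Qed.

(* On a tree every gain function comes from a potential: a partial potential
   extends along an edge leaving its domain B, and two such edges towards the
   same vertex would close a cycle through B. *)
Lemma tree_potential A S (X : Type) (k : N -> N -> X -> X) (x0 : X) :
  is_tree A S ->
  (forall x y t, gadj S x y -> k y x (k x y t) = t) ->
  exists a : N -> X, forall x y, gadj S x y -> a y = k x y (a x).
Proof.
move=> [gS conS acS] kK; have [/set0Pn[r rA] _] := conS.
pose e B := [rel u v | [&& gadj S u v, u \in B & v \in B]].
(* [P B] also records that B is connected through edges inside B; this supplies the path that closes
   the forbidden cycle in [uniq_nb]. *)
pose P B := (forall u v, u \in B -> v \in B -> connect (e B) u v) /\
  exists a : N -> X, forall x y, x \in B -> y \in B -> gadj S x y ->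
    a y = k x y (a x).
suff [_ [a aP]] : P A.
  by exists a => x y xy; have [xA yA] := gadj_graph gS xy; apply: aP.
apply: (graph_ind gS conS rA).
  split=> [u v|]; first by rewrite !inE => /eqP -> /eqP ->.
  exists (fun=> x0) => x y; rewrite !inE => /eqP -> /eqP ->.
  by rewrite /gadj eqxx.
move=> B x y BA [conB [a aB]] xB yA yB xy.
have esym C : symmetric (e C).
  by move=> u v /=; rewrite gadj_sym [(u \in C) && _]andbC.
have conBy u v : u \in B -> v \in B -> connect (e (y |: B)) u v.
  move=> uB vB; apply: (@connect_sub _ (e B)) (conB _ _ uB vB) => s t /=.
  case/and3P=> st sB tB; apply: connect1.
  by rewrite /= st !inE sB tB !orbT.
have conyx : connect (e (y |: B)) y x.
  by apply: connect1; rewrite /= gadj_sym xy !inE eqxx xB orbT.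
have csym := sym_connect_sym (esym (y |: B)).
split.
  move=> u v; rewrite !inE => /orP[/eqP ->|uB] /orP[/eqP ->|vB] //.
  - exact: connect_trans conyx (conBy _ _ xB vB).
  - by rewrite csym; apply: connect_trans conyx (conBy _ _ xB uB).
  - exact: conBy.
have uniq_nb v : v \in B -> gadj S v y -> v = x.
  move=> vB vy; apply/eqP/contraT => vx.
  case/connectP: (conB _ _ xB vB) => p0 p0P vl.
  case: (shortenP p0P) vl => p pP pU _ vl.
  have pB : {subset x :: p <= B}.
    move=> z; rewrite inE => /orP[/eqP -> //|zp].
    elim: (p) (x) pP zp => //= t q IH w /andP[/and3P[_ _ tB] tq].
    by rewrite inE => /orP[/eqP -> //|]; apply: IH tq.
  have pS : path (gadj S) x p.
    by apply: sub_path pP => s t /= /and3P[].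
  have := acS (y :: x :: p).
  rewrite /ucycle /= rcons_path -vl vy gadj_sym xy pS /=.
  have -> : y \notin x :: p by apply: contra yB => /pB.
  move: pU => /= -> /(_ isT); case: (p) vl vx => //=.
  by move=> ->; rewrite eqxx.
exists (fun z => if z == y then k x y (a x) else a z).
move=> u v; rewrite !inE => /orP[/eqP ->|uB] /orP[/eqP ->|vB] uv.
- by move: uv; rewrite /gadj eqxx.
- have -> := uniq_nb v vB; last by rewrite gadj_sym.
  rewrite eqxx kK //; case: eqP => // xy'.
  by move: yB; rewrite -xy' xB.
- rewrite eqxx (uniq_nb _ uB uv); case: eqP => // xy'.
  by move: yB; rewrite -xy' xB.
- have -> : (u == y) = false by apply: contraNF yB => /eqP <-.
  have -> : (v == y) = false by apply: contraNF yB => /eqP <-.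
  exact: aB.
Qed.

Lemma handshake A S :
  is_graph A S ->
  (\sum_(w in A) #|[set x in S | w \in x]| = 2 * #|S|)%N.
Proof.
move=> gS; under eq_bigr => w _.
  rewrite -sum1_card (eq_bigl (fun x => (x \in S) && (w \in x))); last first.
    by move=> e; rewrite inE.
  by rewrite big_mkcondr; over.
rewrite exchange_big /= mulnC -sum_nat_const; apply: eq_bigr => e eS.
have [/subsetP eA e2] := gS e eS; have <- : #|e| = 2%N by [].

rewrite -big_mkcondr sum1_card; apply: eq_card => w.
rewrite unfold_in; apply/andP/idP => [[]//|we]; split=> //; exact: eA.
Qed.

End Graphs.

(** * Incidence numbers and coboundaries on oriented simplices *)

Section Simplices.
Import boot.fintype boot.finset GRing.Theory.
Variables (R : realType) (V : finType) (K : {set {set V}}).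
Variable o : {set V} -> seq V.
Hypothesis Kcx : simplicial_complex K.
Hypothesis oK : orientation K o.
Implicit Types (s t e f : {set V}) (c z : cochain R V).
Local Notation inc := (incidence R o).
Local Notation d := (coboundary_fun K o).

Lemma orient_uniq s : s \in K -> uniq (o s).
Proof. by move=> sK; rewrite (perm_uniq (oK sK)) enum_uniq. Qed.

Lemma mem_orient s : s \in K -> o s =i s.
Proof. by move=> sK x; rewrite (perm_mem (oK sK)) mem_enum. Qed.

Lemma size_orient s : s \in K -> size (o s) = #|s|.
Proof. by move=> sK; rewrite (perm_size (oK sK)) -cardE. Qed.

Lemma cells_sub m s : s \in cells K m -> s \in K.
Proof. by rewrite inE => /andP[]. Qed.

Lemma node_cell v : [set v] \in K.
Proof. by have [_ _] := Kcx. Qed.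

Lemma face_orient f : f \in faces K ->
  exists a b c : V, [/\ o f = [:: a; b; c], a != b, a != c, b != c
    & f = [set a; b; c]].
Proof.
rewrite inE => /andP[fK /eqP f3].
have := size_orient fK; have := orient_uniq fK; have := mem_orient fK.
rewrite f3; case: (o f) => [|a [|b [|c [|]]]] //= memf.
rewrite !inE negb_or => /andP[/andP[ab ac] /andP[bc _]] _.
exists a, b, c; split=> //; apply/setP => x.
by rewrite -memf !inE orbA.
Qed.

Lemma edge_orient e : e \in edges K ->
  exists a b : V, [/\ o e = [:: a; b], a != b & e = [set a; b]].
Proof.
rewrite inE => /andP[eK /eqP e2].
have := size_orient eK; have := orient_uniq eK; have := mem_orient eK.
rewrite e2; case: (o e) => [|a [|b [|]]] //= meme.
rewrite !inE => /andP[ab _] _.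
exists a, b; split=> //; apply/setP => x.
by rewrite -meme !inE.
Qed.

Lemma node_orient v : o [set v] = [:: v].
Proof.
have vK := node_cell v.
have := size_orient vK; have := mem_orient vK; rewrite cards1.
case: (o _) => [|a [|]] //= mema _; congr [:: _].
by apply/eqP; rewrite -in_set1 -mema inE.
Qed.

Lemma edge_orient2 a b : a != b -> [set a; b] \in K ->
  o [set a; b] = [:: a; b] \/ o [set a; b] = [:: b; a].
Proof.
move=> ab abK.
have := size_orient abK; have := orient_uniq abK; have := mem_orient abK.
rewrite cards2 ab; case: (o _) => [|x [|y [|]]] //= memxy.
rewrite !inE => /andP[xy _] _.
have := memxy a; have := memxy b; rewrite !inE !eqxx ?orbT.
move=> bxy axy; move: ab.
case/orP: bxy => /eqP ->; case/orP: axy => /eqP ->; rewrite ?eqxx // => _.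
- by right.
- by left.
Qed.

Lemma edge_cell a b : a != b -> [set a; b] \in K -> [set a; b] \in edges K.
Proof. by move=> ab abK; rewrite inE abK cards2 ab. Qed.

(** Cochains of all degrees live in one space and the coboundary sums over all of K; comparing
    lengths confines that sum to cells one dimension lower. *)
Lemma incidence_size s t :
  inc s t != 0 -> size (o s) = (size (o t)).+1.
Proof.
rewrite /incidence; case: (o s) => [|x1 [|x2 [|x3 [|? ?]]]] //=;
  case: (o t) => [|y1 [|y2 [|? ?]]] //=; by rewrite eqxx.
Qed.

Lemma incidence_cells m s t :
  s \in cells K m.+1 -> t \in K -> t \notin cells K m -> inc s t = 0.
Proof.
rewrite !inE => /andP[sK /eqP sm] tK; rewrite tK /= => tm.
apply/eqP; apply: contraNT tm => /incidence_size.
by rewrite !size_orient // sm => -[->].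
Qed.

Lemma incidence_notin f e :
  f \in faces K -> e \in edges K -> ~~ (e \subset f) -> inc f e = 0.
Proof.
move=> fF eE; have [a [b [c [fo _ _ _ fE]]]] := face_orient fF.
have [u [w [eo _ eE']]] := edge_orient eE.
rewrite /incidence fo eo fE eE' subUset !sub1set !inE => H.
case: ifP => [uw|_]; [|case: ifP => // uw]; case/negP: H; move: uw;
  rewrite !xpair_eqE => /or3P[] /andP[/eqP -> /eqP ->];
  by rewrite !eqxx ?orbT.
Qed.

(** The form in which an incidence number is used as a sign: later computations rewrite with the
    square instead of splitting on the two orientations. *)
Lemma incidence_sq f e :
  f \in faces K -> e \in edges K -> e \subset f -> inc f e * inc f e = 1.
Proof.
move=> fF eE; have [a [b [c [fo ab ac bc fE]]]] := face_orient fF.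
have [u [w [eo uw eE']]] := edge_orient eE.
rewrite /incidence fo eo fE eE' subUset => /andP[].
rewrite !sub1set => uf wf.
have H : ((u, w) \in [:: (a, b); (b, c); (c, a)]) ||
         ((w, u) \in [:: (a, b); (b, c); (c, a)]).
  move: uf wf; rewrite !inE !xpair_eqE -!orbA => uf wf.
  move: uw uf wf => /[swap] /or3P[] /eqP -> /[swap] /or3P[] /eqP ->;
    by rewrite !eqxx ?andbT ?orbT.
case: ifP H => [_ _|_ /= ->]; first by rewrite mulr1.
by rewrite mulrNN mulr1.
Qed.

Lemma coboundaryE c s :
  s \in K -> d c s = \sum_(t in K) inc s t * c t.
Proof. by move=> sK; rewrite ffunE sK. Qed.

Lemma coboundary_edge c e a b :
  e \in edges K -> o e = [:: a; b] -> d c e = c [set b] - c [set a].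
Proof.
move=> eE eo; have eK := cells_sub eE.
have ab : a != b.
  by have := orient_uniq eK; rewrite eo /= inE => /andP[].
rewrite coboundaryE //.
rewrite (bigD1 [set b]) ?node_cell //= (bigD1 [set a]) ?node_cell /=;
  last first.
  by rewrite eqEsubset !sub1set !inE (negbTE ab).
rewrite big1 ?addr0; last first.
  move=> t /andP[/andP[tK tb] ta].
  have [t0|/(incidence_cells eE tK) ->] := boolP (t \in cells K 0); last first.
    by rewrite mul0r.
  move: t0; rewrite inE => /andP[_ /cards1P[v tv]].
  move: ta tb; rewrite tv => va vb; rewrite /incidence eo node_orient.
  case: eqP => [vb'|_]; first by rewrite vb' eqxx in vb.
  case: eqP => [va'|_]; first by rewrite va' eqxx in va.
  by rewrite mul0r.
by rewrite /incidence eo !node_orient !eqxx (negbTE ab) mul1r mulN1r.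
Qed.

Lemma coboundary_face z f :
  f \in faces K -> d z f = \sum_(e in edges K) inc f e * z e.
Proof.
move=> fF; rewrite coboundaryE ?(cells_sub fF) //.
rewrite (bigID (fun t => t \in edges K)) /= [X in _ + X]big1 ?addr0;
  last first.
  by move=> t /andP[tK tE]; rewrite (incidence_cells fF tK tE) mul0r.
by apply: eq_bigl => t; rewrite !inE andbA andbb.
Qed.

(** Along the cycle a, b, x each edge of f contributes the value at its head minus the value at its
    tail, whichever way the edge itself is oriented ([key]), and the three differences cancel. *)
Lemma coboundary_coboundary c f : f \in faces K -> d (d c) f = 0.
Proof.
move=> fF; rewrite coboundary_face //.
have [a [b [x [fo ab ax bx fE]]]] := face_orient fF.
have fK := cells_sub fF.
have [_ Kdown _] := Kcx.
have subK u w : u \in f -> w \in f -> [set u; w] \in K.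
  move=> uf wf; apply: Kdown fK _ _; first by rewrite subUset !sub1set uf.
  by apply/set0Pn; exists u; rewrite !inE eqxx.
have [af bf xf] : [/\ a \in f, b \in f & x \in f].
  by rewrite fE !inE !eqxx ?orbT.
have xa : x != a by rewrite eq_sym.
have key u w : u != w -> (u, w) \in [:: (a, b); (b, x); (x, a)] ->
    inc f [set u; w] * d c [set u; w] = c [set w] - c [set u].
  move=> uw uwf.
  have uwK : [set u; w] \in K.
    by move: uwf; rewrite !inE !xpair_eqE => /or3P[] /andP[/eqP -> /eqP ->];
      apply: subK.
  have [uwo|uwo] := edge_orient2 uw uwK.
    rewrite (coboundary_edge _ _ uwo) ?edge_cell //.
    by rewrite /incidence fo uwo uwf mul1r.
  rewrite (coboundary_edge _ _ uwo) ?edge_cell // /incidence fo uwo uwf.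
  rewrite ifN ?mulN1r ?opprB //.
  move: uwf; rewrite !inE !xpair_eqE => /or3P[] /andP[/eqP -> /eqP ->];
  by rewrite ?(negbTE ab) ?(negbTE ax) ?(negbTE bx) ?[b == a]eq_sym
     ?[x == a]eq_sym ?[x == b]eq_sym ?(negbTE ab) ?(negbTE ax) ?(negbTE bx)
     ?andbF.
have neq (u w v y : V) : (v \notin [set u; w]) || (y \notin [set u; w]) ->
    [set v; y] != [set u; w].
  by apply: contraTneq => <-; rewrite !inE !eqxx ?orbT.
have E2 u w : u != w -> u \in f -> w \in f -> [set u; w] \in edges K.
  by move=> uw uf wf; rewrite edge_cell // subK.
have xb : x != b by rewrite eq_sym.
have ba : b != a by rewrite eq_sym.
have eqs := (negbTE xa, negbTE ab, negbTE ax, negbTE bx, negbTE xb, negbTE ba).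
rewrite (bigD1 [set a; b]) ?E2 //= (bigD1 [set b; x]) /=; last first.
  by rewrite E2 //= neq // !inE !eqs ?eqxx ?orbT.
rewrite (bigD1 [set x; a]) /=; last first.
  by rewrite E2 //= neq ?neq // !inE !eqs ?eqxx ?orbT.
rewrite big1 ?addr0; last first.
  move=> e /andP[/andP[/andP[eE eab] ebx] exa].
  have [ef|ef] := boolP (e \subset f); last first.
    by rewrite incidence_notin ?mul0r.
  have [u [w [_ uw euw]]] := edge_orient eE.
  exfalso; move: ef eab ebx exa uw; rewrite {}euw fE subUset !sub1set !inE
    -!orbA.
  case/andP=> /or3P[] /eqP -> /or3P[] /eqP ->;
  by rewrite ?eqxx // ?[[set b; a]]setUC ?[[set x; b]]setUC ?[[set a; x]]setUC
     ?eqxx.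
by rewrite !key ?inE ?eqxx ?orbT //; ring.
Qed.

Lemma coboundary_supp m c s :
  (forall t, t \notin cells K m -> c t = 0) -> s \notin cells K m.+1 ->
  d c s = 0.
Proof.
move=> cm sm; rewrite ffunE; case: ifP => // sK; apply: big1 => t tK.
have [tm|/cm ->] := boolP (t \in cells K m); last by rewrite mulr0.
suff -> : inc s t = 0 by rewrite mul0r.
apply/eqP; apply: contraNT sm => /incidence_size.
rewrite !size_orient // inE sK => ->.
by move: tm; rewrite inE => /andP[_ /eqP ->]; rewrite eqxx.
Qed.

(** Summation by parts: a weight on the faces is moved to the edges. Both [stokes] and
    [tree_supported_eq0] are instances for a suitable weight. *)
Lemma sum_coboundary (F : {set V} -> R) z :
  \sum_(f in faces K) F f * d z f =
  \sum_(e in edges K) z e * \sum_(f in cofaces K e) F f * inc f e.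
Proof.
under eq_bigr => f fF do rewrite (coboundary_face _ fF) mulr_sumr.
rewrite exchange_big /=; apply: eq_bigr => e eE; rewrite mulr_sumr.
rewrite (bigID (fun f => e \subset f)) /= [X in _ + X]big1 ?addr0; last first.
  by move=> f /andP[fF ef]; rewrite incidence_notin // mul0r mulr0.
rewrite [RHS](eq_bigl (fun f => (f \in faces K) && (e \subset f))); last first.
  by move=> f; rewrite !inE.
by apply: eq_bigr => f _; rewrite mulrA mulrC.
Qed.

End Simplices.

(** * Boundary cells and links of nodes of a triangulated surface *)

Section Surfaces.
Import boot.fintype boot.finset.
Variables (V : finType) (K : {set {set V}}).
Hypothesis KS : surface_complex K.
Implicit Types (s t e f : {set V}) (v w : V).

Let Kcx : simplicial_complex K. Proof. by case: KS. Qed.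

Lemma face_closed s t : s \in K -> t \subset s -> t != set0 -> t \in K.
Proof. by case: Kcx => _ + _; apply. Qed.

Lemma cofaces_card e : e \in edges K -> (0 < #|cofaces K e| <= 2)%N.
Proof.
move=> eE; have [_ pureK deg2 _ _] := KS; rewrite deg2 // andbT card_gt0.
have [f fF ef] := pureK e (cells_sub eE).
by apply/set0Pn; exists f; rewrite inE fF.
Qed.

Lemma bd_edgesE e : (e \in bd_edges K) = (e \in edges K) && (#|cofaces K e| ==
  1%N).
Proof. by rewrite inE. Qed.

Lemma cofaces_internal e :
  e \in edges K -> e \notin bd_edges K -> #|cofaces K e| = 2.
Proof.
move=> eE; rewrite bd_edgesE eE /=; have := cofaces_card eE.
by case: #|_| => [|[|[|]]].
Qed.

Lemma bd_cells s : s \in bd K -> (s \in bd_edges K) || (s \in cells K 0).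
Proof.
rewrite inE => /andP[sK /existsP[e /andP[eB se]]].
have [eE _] : e \in edges K /\ True by move: eB; rewrite inE => /andP[].
have e2 : #|e| = 2 by move: eE; rewrite inE => /andP[_ /eqP].
have := subset_leq_card se; rewrite e2.
case s2 : #|s| => [|[|[|n]]] // _.
- have [K0 _ _] := Kcx; move: sK; rewrite (cards0_eq s2).
  by rewrite (negbTE K0).
- by rewrite [X in _ || X]inE sK s2 orbT.
- suff -> : s = e by rewrite eB.
  by apply/eqP; rewrite eqEcard se s2 e2.
Qed.

Lemma bd_edge_bd e : e \in bd_edges K -> e \in bd K.
Proof.
move=> eB; rewrite inE; apply/andP; split.
  by move: eB; rewrite !inE => /andP[/andP[]].
by apply/existsP; exists e; rewrite eB subxx.
Qed.

Lemma edges_bd : edges (bd K) = bd_edges K.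
Proof.
apply/setP => e; rewrite inE; apply/andP/idP => [[/bd_cells /orP[] //]|eB].
  by rewrite inE => /andP[_ /eqP ->].
split; first exact: bd_edge_bd.
by move: eB; rewrite !inE => /andP[/andP[]].
Qed.

Lemma bd_edge_edge e : e \in bd_edges K -> e \in edges K.
Proof. by rewrite inE => /andP[]. Qed.

Lemma bd_node e v : e \in bd_edges K -> v \in e -> [set v] \in bd K.
Proof.
move=> eB ve; rewrite inE (node_cell Kcx) /=; apply/existsP; exists e.
by rewrite eB sub1set.
Qed.

Lemma link_graph v : is_graph (link_nodes K v) (link_edges K v).
Proof.
move=> e; rewrite inE => /and3P[eE ve veK]; split; last first.
  by move: eE; rewrite inE => /andP[_ /eqP].
apply/subsetP => w we; rewrite inE; apply/andP; split.
  by apply: contraNneq ve => <-.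
apply: face_closed veK _ _; last by apply/set0Pn; exists v; rewrite !inE eqxx.
by rewrite subUset !sub1set !inE eqxx we orbT.
Qed.

(** Removing v maps the triangles on the edge from v to w bijectively onto the link edges at w. *)
Lemma link_degree v w : w \in link_nodes K v ->
  #|[set e in link_edges K v | w \in e]| = #|cofaces K [set v; w]|.
Proof.
rewrite inE => /andP[wv vwK].
have inj : {in cofaces K [set v; w] &, injective (fun f : {set V} => f :\ v)}.
  move=> f g; rewrite !inE !subUset !sub1set => /and3P[_ vf _] /and3P[_ vg _].
  by move=> fg; rewrite -(setD1K vf) fg setD1K.
rewrite -(card_in_imset inj); apply: eq_card => e; apply/idP/imsetP.
  rewrite !inE => /andP[/and3P[/andP[eK /eqP e2] ve veK] we].
  exists (v |: e); last by rewrite setU1K.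
  by rewrite !inE veK cardsU1 ve e2 /= subUset !sub1set !inE eqxx we orbT.
case=> f; rewrite !inE subUset !sub1set.
move=> /andP[/andP[fK /eqP f3] /andP[vf wf]] ->.
have fv2 : #|f :\ v| = 2 by move: f3; rewrite (cardsD1 v) vf => -[].
rewrite fv2 setD1K // fK !inE eqxx wv wf /= !andbT.
apply: face_closed fK _ _; first by rewrite subsetDl.
by rewrite -card_gt0 fv2.
Qed.

(** In the link of v the boundary edges at v appear as vertices of degree 1, all others having
    degree 2. Counting degrees makes their number even, and connectedness, which forces at least as
    many link edges as vertices minus one, bounds it by 2. *)
Lemma bd_degree v :
  ~~ odd #|[set e in bd_edges K | v \in e]| /\
  (#|[set e in bd_edges K | v \in e]| <= 2)%N.
Proof.
have [_ _ _ conL _] := KS.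
have cardL := connected_card (@link_graph v) (conL v).
have degE := handshake (@link_graph v).
set D := #|[set e in _ | _]|.
suff DE : (D + 2 * #|link_edges K v| = 2 * #|link_nodes K v|)%N by split; lia.
have vwE w : w \in link_nodes K v -> [set v; w] \in edges K.
  by rewrite inE => /andP[wv vwK]; rewrite inE vwK cards2 [v == w]eq_sym wv.
have -> : D = (\sum_(w in link_nodes K v) nat_of_bool (#|cofaces K [set v;
  w]| == 1))%N.
  have inj : {in [set w in link_nodes K v | #|cofaces K [set v; w]| == 1%N] &,
      injective (fun w => [set v; w])}.
    move=> w w'; rewrite !inE => /andP[/andP[wv _] _] _ /setP/(_ w).
    by rewrite !inE eqxx orbT (negbTE wv) => /esym/eqP.
  transitivity #|[set w in link_nodes K v | #|cofaces K [set v; w]| == 1%N]|.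
    rewrite -(card_in_imset inj); apply: eq_card => e; apply/idP/imsetP.
      move=> eBv; have /andP[eB ve] : (e \in bd_edges K) && (v \in e).
        by rewrite inE in eBv.
      have /cards2P[a [b [ab eE]]] : #|e| == 2%N.
        by move: (bd_edge_edge eB); rewrite inE => /andP[].
      have eK := cells_sub (bd_edge_edge eB).
      move: ve; rewrite eE !inE => /orP[] /eqP vE; [exists b|exists a];
        rewrite ?vE // 1?[[set b; a]]setUC // !inE.
      + by rewrite eq_sym ab -eE eK; move: eB; rewrite inE => /andP[].
      + by rewrite ab [[set b; a]]setUC -eE eK; move: eB;
        rewrite inE => /andP[].
    case=> w wc ->; have /andP[wL c1] := etrans (esym (in_set _ _)) wc.
    by rewrite inE bd_edgesE vwE // c1 !inE eqxx.
  rewrite -sum1_card big_mkcond [RHS]big_mkcond /=; apply: eq_bigr => w _.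
  by rewrite [in LHS]inE; case: (w \in _) => //=; case: eqP.
(* Every link vertex contributes 2 to the left side: 1 + 1 on the boundary, 0 + 2 inside. *)
rewrite -degE mulnC -sum_nat_const -big_split /=; apply: eq_bigr => w wL.
rewrite link_degree //; have := cofaces_card (vwE w wL).
by case: #|_| => [|[|[|]]].
Qed.

End Surfaces.

(** * Connected components of a set of open cells *)

Section Components.
Import boot.fintype boot.finset.
Variables (V : finType) (L : {set {set V}}).
Implicit Types (s t : {set V}) (C : {set {set V}}).

Lemma cell_adj_sym : symmetric (cell_adj L).
Proof.
by move=> s t; rewrite /cell_adj [(t \proper s) || _]orbC andbCA.
Qed.

Lemma component_sub C s : C \in components L -> s \in C -> s \in L.
Proof. by case/imsetP => x _ ->; rewrite inE => /andP[]. Qed.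

Lemma component_connect C s : C \in components L -> s \in C ->
  C = [set t in L | connect (cell_adj L) s t].
Proof.
have csym := sym_connect_sym cell_adj_sym.
case/imsetP => x _ ->; rewrite inE => /andP[_ xs].
by apply/setP => t; rewrite !inE (same_connect csym xs).
Qed.

Lemma component_adj C s t : C \in components L -> s \in C ->
  cell_adj L s t -> t \in C.
Proof.
move=> CL sC st; rewrite (component_connect CL sC) inE connect1 // andbT.
by case/and3P: st.
Qed.

Lemma component_inj C C' s : C \in components L -> C' \in components L ->
  s \in C -> s \in C' -> C = C'.
Proof.
move=> CL C'L sC sC'.
by rewrite (component_connect CL sC) (component_connect C'L sC').
Qed.

Lemma component_exists s : s \in L ->
  exists2 C, C \in components L & s \in C.
Proof.
move=> sL; exists [set t in L | connect (cell_adj L) s t].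
  by apply/imsetP; exists s.
by rewrite inE sL connect0.
Qed.

End Components.

(** * Induction along connections and spans, and a criterion for direct sums *)

Lemma connect_ind (T : finType) (e : rel T) (P : T -> Prop) x y :
  (forall u v, e u v -> P u -> P v) -> connect e x y -> P x -> P y.
Proof.
move=> eP /connectP[p]; elim: p x => [|z p IH] x /=; first by move=> _ ->.
by move=> /andP[xz zp] yl Px; apply: (IH z) => //; apply: eP xz Px.
Qed.

Lemma span_ind (F : fieldType) (vT : vectType F) (P : vT -> Prop)
    (X : seq vT) :
  P 0 -> (forall a u v, P u -> P v -> P (a *: u + v)) ->
  (forall u, u \in X -> P u) -> forall v, v \in <<X>>%VS -> P v.
Proof.
move=> P0 Plin; elim: X => [|u X IH] PX v.
  by rewrite span_nil memv0 => /eqP ->.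
rewrite span_cons => /memv_addP[u' /vlineP[a ->]] [v' v'X ->].
apply: Plin; first by apply: PX; rewrite mem_head.
by apply: IH v'X => w wX; apply: PX; rewrite in_cons wX orbT.
Qed.

Section DirectSum.
Import GRing.Theory.
Variables (F : fieldType) (vT : vectType F) (U1 U2 U3 W : {vspace vT}).

(** The map is addition of the three components; the hypotheses say in turn that it lands in W, is
    onto, and has trivial kernel. *)
Lemma sum_hom_exists :
  (forall x y z, x \in U1 -> y \in U2 -> z \in U3 -> x + y + z \in W) ->
  (forall w, w \in W -> exists x y z,
     [/\ x \in U1, y \in U2, z \in U3 & w = x + y + z]) ->
  (forall x y z, x \in U1 -> y \in U2 -> z \in U3 -> x + y + z = 0 ->
     [/\ x = 0, y = 0 & z = 0]) ->
  exists2 f : 'Hom((subvs_of U1 * subvs_of U2 * subvs_of U3)%type, subvs_of W),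
    bijective f
    & forall x y z, vsval (f (x, y, z)) = vsval x + vsval y + vsval z.
Proof.
move=> UW WU U0.
pose g (p : (subvs_of U1 * subvs_of U2 * subvs_of U3)%type) : subvs_of W :=
  vsproj W (vsval p.1.1 + vsval p.1.2 + vsval p.2).
have gE x y z : vsval (g (x, y, z)) = vsval x + vsval y + vsval z.
  by rewrite /g vsprojK //; apply: UW; apply: subvsP.
have glin : linear g.
  move=> a [[x y] z] [[x' y'] z']; apply: val_inj.
  rewrite [RHS]/= !gE [LHS](gE (a *: x + x') (a *: y + y') (a *: z + z')) /=.
  by rewrite !scalerDr [RHS]addrACA; congr (_ + _); rewrite addrACA.
pose gL := GRing.isLinear.Build _ _ _ _ g glin.
pose gl : {linear _ -> _} := HB.pack g gL.
have lE p : linfun gl p = g p by rewrite lfunE.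
exists (linfun gl); last by move=> x y z; rewrite lE gE.
have inj : injective (linfun gl).
  move=> p q pq; apply/eqP; rewrite -subr_eq0; apply/eqP.
  have : linfun gl (p - q) = 0 by rewrite linearB; apply/eqP;
    rewrite subr_eq0; apply/eqP; exact: pq.
  case: (p - q) => [[x y] z]; rewrite lE => /(congr1 vsval).
  rewrite gE linear0 => /(U0 _ _ _ (subvsP x) (subvsP y) (subvsP z))[x0 y0 z0].
  by congr (_, _, _); apply: val_inj; rewrite ?x0 ?y0 ?z0.
have surj w : exists p, linfun gl p = w.
  have [x [y [z [xU yU zU E]]]] := WU _ (subvsP w).
  exists (vsproj U1 x, vsproj U2 y, vsproj U3 z); rewrite lE.
  by apply: val_inj; apply: (etrans (gE _ _ _)); rewrite !vsprojK // -E.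
have /choice[k kP] := surj.
by exists k => // p; apply: inj; rewrite kP.
Qed.

End DirectSum.

(** * The dual spanning tree and its paths *)

Section GlobalLoops.
Import boot.fintype boot.finset GRing.Theory Num.Theory.
Variables (R : realType) (V : finType) (K : {set {set V}}).
Variable o : {set V} -> seq V.
Hypothesis KS : surface_complex K.
Hypothesis oK : orientation K o.
Variables (ET : {set {set V}}) (T0 Tt : {set {set {set V}}}).
Hypothesis T0P :
  spanning_tree (faces K) [set dual_edge K e | e in edges K :\: ET] T0.
Hypothesis TtE : Tt = T0 :|: [set dual_edge K e | e in bd_edges K :\: ET].
Implicit Types (e f : {set V}) (z : cochain R V) (C : {set {set V}}).
Local Notation inc := (incidence R o).
Local Notation d := (coboundary_fun K o).

Let Kcx : simplicial_complex K. Proof. by case: KS. Qed.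

(** The primal edges crossed by [T0]. The leaves that [Tt] adds for boundary edges are left out, so
    every flux along the tree lives on internal edges. *)
Definition tree_edges : {set {set V}} :=
  [set e in edges K | (e \notin bd_edges K) && (cofaces K e \in T0)].

Lemma edge_not_face e : e \in edges K -> e \notin faces K.
Proof. by rewrite !inE => /andP[_ /eqP ->]; rewrite andbF. Qed.

Lemma cofaceP e f : f \in cofaces K e -> (f \in faces K) /\ (e \subset f).
Proof. by rewrite inE => /andP[]. Qed.

(** Two distinct triangles share at most two nodes. This justifies recovering the edge between
    consecutive faces of a path as their intersection, as [transport_along] does. *)
Lemma coface_inter e f f' : e \in edges K ->
  f \in cofaces K e -> f' \in cofaces K e -> f != f' -> f :&: f' = e.
Proof.
move=> eE /cofaceP[fF ef] /cofaceP[f'F ef'] ff'.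
have e2 : #|e| = 2%N by move: eE; rewrite inE => /andP[_ /eqP].
have f3 : #|f| = 3%N by move: fF; rewrite inE => /andP[_ /eqP].
have f'3 : #|f'| = 3%N by move: f'F; rewrite inE => /andP[_ /eqP].
apply/esym/eqP; rewrite eqEcard subsetI ef ef' e2 /=.
rewrite leqNgt; apply: contra ff' => lt2.
have fE : f :&: f' = f by apply/eqP; rewrite eqEcard subsetIl f3.
by rewrite eqEcard f3 f'3 -{1}fE subsetIr.
Qed.

Lemma dual_edge_internal e : e \notin bd_edges K -> dual_edge K e = cofaces K
  e.
Proof. by rewrite /dual_edge => /negbTE ->; rewrite setU0. Qed.

Lemma internal_cofaces e : e \in edges K -> e \notin bd_edges K ->
  exists f f', [/\ f != f', cofaces K e = [set f; f'] & f :&: f' = e].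
Proof.
move=> eE eB; have /eqP/cards2P[f [f' [ff' ce]]] := cofaces_internal KS eE eB.
exists f, f'; split=> //; apply: coface_inter => //.
  by rewrite ce set21.
by rewrite ce set22.
Qed.

Lemma dual_tree_graph : is_graph (faces K) T0.
Proof. by case: T0P => _ []. Qed.

(** Both ends of an edge of [T0] are faces, whereas the dual edge of a boundary edge e has e itself
    as an end. *)
Lemma T0_cofaces t : t \in T0 ->
  exists e, [/\ e \in edges K, e \notin ET, e \notin bd_edges K
    & t = cofaces K e].
Proof.
move=> tT; have [/subsetP/(_ t tT) /imsetP[e]] := T0P.
rewrite inE => /andP[eET eE] tE _; have [tF _] := dual_tree_graph tT.
have eB : e \notin bd_edges K.
  apply: contra (edge_not_face eE) => eB; apply: (subsetP tF).
  by rewrite tE /dual_edge eB !inE eqxx orbT.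
by exists e; rewrite -dual_edge_internal.
Qed.

Lemma gadj_tree f f' : gadj T0 f f' ->
  [/\ f :&: f' \in tree_edges, cofaces K (f :&: f') = [set f; f'],
      f \in faces K & f' \in faces K].
Proof.
move=> ff'T; have [fF f'F] := gadj_graph dual_tree_graph ff'T.
case/andP: ff'T => ff' T; have [e [eE eET eB ce]] := T0_cofaces T.
have eI : f :&: f' = e.
  by apply: coface_inter => //; rewrite -ce !inE eqxx ?orbT.
by rewrite eI; split=> //; rewrite inE eE eB -ce.
Qed.

Lemma tree_edge_edge e : e \in tree_edges -> e \in edges K.
Proof. by rewrite inE => /andP[]. Qed.

Lemma tree_edge_internal e : e \in tree_edges -> e \notin bd_edges K.
Proof. by rewrite inE => /and3P[]. Qed.

Lemma tree_edgeP e : e \in tree_edges ->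
  exists f f', [/\ gadj T0 f f', cofaces K e = [set f; f'] & f :&: f' = e].
Proof.
rewrite inE => /and3P[eE eB eT].
have [f [f' [ff' ce eI]]] := internal_cofaces eE eB.
by exists f, f'; rewrite /gadj ff' -ce.
Qed.

Lemma tree_edge_notin_ET e : e \in tree_edges -> e \notin ET.
Proof.
move=> eT; have [f [f' [ff' ce eI]]] := tree_edgeP eT.
have /andP[nff' T] := ff'; have [e' [e'E e'ET _ ce']] := T0_cofaces T.
suff -> : e = e' by [].
by rewrite -eI; apply: coface_inter => //; rewrite -ce' !inE eqxx ?orbT.
Qed.

Lemma edge_cases e : e \in edges K -> e \notin bd_edges K -> e \notin ET ->
  (e \in tree_edges) || (e \in Defs.EM K ET Tt).
Proof.
move=> eE eB eET; have -> : (e \in tree_edges) = (cofaces K e \in T0) by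
  rewrite in_set eE eB.
have -> : (e \in Defs.EM K ET Tt) = (dual_edge K e \notin Tt).
  by rewrite in_set eE eET.
rewrite -implyNb; apply/implyP => cT; rewrite TtE inE negb_or.
rewrite dual_edge_internal // cT /=; apply/imsetP => -[e'].
rewrite inE => /andP[_ e'B] ce.
have : e' \in cofaces K e by rewrite ce /dual_edge e'B !inE eqxx orbT.
by case/cofaceP; rewrite (negbTE (edge_not_face (bd_edge_edge e'B))).
Qed.

(** [Tt] contains the dual edges of all boundary edges off [ET], so an edge outside both trees is
    internal. *)
Lemma EM_edge e : e \in Defs.EM K ET Tt ->
  [/\ e \in edges K, e \notin bd_edges K, e \notin ET & e \notin tree_edges].
Proof.
rewrite inE => /and3P[eE eET]; rewrite TtE inE negb_or => /andP[eT0 eT].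
have eB : e \notin bd_edges K.
  by apply: contra eT => eB; apply: imset_f; rewrite inE eET.
split=> //; rewrite inE eE eB /=.
by rewrite -dual_edge_internal.
Qed.

Lemma gadj_Tt_faces f f' : gadj Tt f f' -> f \in faces K -> f' \in faces K ->
  gadj T0 f f'.
Proof.
case/andP=> ff'; rewrite TtE inE /gadj ff' => /orP[-> //|/imsetP[e]].
rewrite inE => /andP[_ eB] dE fF f'F.
have : e \in [set f; f'] by rewrite dE /dual_edge eB !inE eqxx orbT.
have := edge_not_face (bd_edge_edge eB).
by move=> eF /set2P[] eE; rewrite eE ?fF ?f'F in eF.
Qed.

Lemma gadj_Tt_leaf x y : gadj Tt x y -> x \notin faces K ->
  cofaces K x = [set y].
Proof.
move=> /andP[xy]; rewrite TtE inE => /orP[/dual_tree_graph[/subsetP sub _]|].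
  by rewrite sub // !inE eqxx.
case/imsetP=> e; rewrite inE => /andP[_ eB] dE xF.
have /cards1P[h ch] : #|cofaces K e| == 1%N.
  by move: eB; rewrite bd_edgesE => /andP[].
have hF : h \in faces K.
  by have /cofaceP[] : h \in cofaces K e by rewrite ch set11.
rewrite /dual_edge eB ch in dE.
have : x \in [set h] :|: [set e] by rewrite -dE set21.
rewrite !inE => /orP[/eqP xh|/eqP xe]; first by rewrite xh hF in xF.
have : y \in [set h] :|: [set e] by rewrite -dE set22.
rewrite !inE => /orP[/eqP yh|/eqP ye]; first by rewrite xe ch yh.
by rewrite xe ye eqxx in xy.
Qed.

(** A boundary dual node is a leaf of [Tt]: a path between faces that entered one would have to
    return to the face it came from, against [uniq]. *)
Lemma path_Tt f q : f \in faces K -> last f q \in faces K ->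
  path (gadj Tt) f q -> uniq (f :: q) -> path (gadj T0) f q.
Proof.
elim: q f => //= v q IH f fF lF /andP[fv vq] /andP[fq uq].
have [vF|vF] := boolP (v \in faces K).
  by rewrite gadj_Tt_faces //= IH.
exfalso; case: q vq lF fq {uq IH} => [|w q] /=; first by rewrite (negbTE vF).
move=> /andP[vw _] _; have cw := gadj_Tt_leaf vw vF.
have : cofaces K v = [set f] by apply: gadj_Tt_leaf; rewrite 1?gadj_sym.
by rewrite cw => /set1_inj ->; rewrite !inE eqxx orbT.
Qed.

(** [tree_path] is an [xget] choice, meaningful once some simple path exists; connectedness of [T0]
    provides one. *)
Lemma tree_pathP f f' : f \in faces K -> f' \in faces K ->
  exists q, [/\ tree_path Tt f f' = f :: q, path (gadj T0) f q,
    last f q = f' & uniq (f :: q)].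
Proof.
move=> fF f'F; rewrite /tree_path.
suff /(@xgetPex _ [::])[q [-> pq lq uq]] : exists p, simple_path Tt f f' p.
  by exists q; split=> //; apply: path_Tt; rewrite ?lq.
have [_ [_ [_ con] _]] := T0P.
case/connectP: (con f f' fF f'F) => q0 q0P f'E.
case: (shortenP q0P) f'E => q qP qU _ lq.
exists (f :: q), q; split=> //; apply: sub_path qP => x y.
by apply: gadj_subset; rewrite TtE subsetUl.
Qed.

(** A sign function is a boolean potential on the dual tree: crossing an edge flips it exactly when
    the two faces have the same incidence number with that edge. *)
Lemma omega_exists : exists w : {set V} -> R,
  (forall f, w f * w f = 1) /\
  (forall f f', gadj T0 f f' ->
     w f * inc f (f :&: f') + w f' * inc f' (f :&: f') = 0).
Proof.
have [_ T0t] := T0P.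
pose k f f' b := b (+) (inc f (f :&: f') == inc f' (f :&: f')).
have [a aP] : exists a : {set V} -> bool, forall x y, gadj T0 x y ->
    a y = k x y (a x).
  apply: (tree_potential true T0t) => x y t _.
  by rewrite /k setIC [X in _ (+) X]eq_sym addbK.
exists (fun f => (-1) ^+ a f); split=> [f|f f' ff'].
  by rewrite -expr2 sqrr_sign.
have [eT ce fF f'F] := gadj_tree ff'.
have eE := tree_edge_edge eT.
rewrite (aP _ _ ff') /k signr_addb -mulrA -mulrDr.
apply/eqP; rewrite mulf_eq0 signr_eq0 /=.
have := incidence_sq R oK fF eE (subsetIl _ _).
have := incidence_sq R oK f'F eE (subsetIr _ _).
set u := inc f _; set v := inc f' _ => vv uu.
case: (u =P v) => [->|uv]; first by rewrite mulN1r subrr.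
rewrite mul1r; have : (u - v) * (u + v) == 0.
  by rewrite -subr_sqr !expr2 uu vv subrr.
by rewrite mulf_eq0 subr_eq0 (introF eqP uv).
Qed.

(** * Coherent signs and a closed form of the transport procedure *)

Variable omega : {set V} -> R.
Hypothesis omega_sq : forall f, omega f * omega f = 1.
Hypothesis omega_tree : forall f f', gadj T0 f f' ->
  omega f * inc f (f :&: f') + omega f' * inc f' (f :&: f') = 0.

Definition osign f e : R := omega f * inc f e.
Local Notation s := osign.

Lemma osign_sq f e : f \in faces K -> e \in edges K -> e \subset f ->
  s f e * s f e = 1.
Proof.
move=> fF eE ef; rewrite /s mulrACA omega_sq mul1r.
exact: (incidence_sq R oK fF eE ef).
Qed.

Lemma osign_sq_coface f e : e \in edges K -> f \in cofaces K e ->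
  s f e * s f e = 1.
Proof. by move=> eE /cofaceP[fF ef]; apply: osign_sq. Qed.

Lemma osign_tree f f' : gadj T0 f f' -> s f' (f :&: f') = - s f (f :&: f').
Proof. by move/omega_tree/eqP; rewrite addrC addr_eq0 => /eqP. Qed.

Lemma coboundary_elementary e f : e \in edges K -> f \in faces K ->
  d (elementary R e) f = inc f e.
Proof.
move=> eE fF; rewrite (coboundary_face oK) // (bigD1 e) //= big1 ?addr0.
  by rewrite ffunE eqxx mulr1.
by move=> e' /andP[_ e'e]; rewrite ffunE (negbTE e'e) mulr0.
Qed.

(** The unit flow along the path: each crossed edge carries the sign with which the face being left
    sees it. Its weighted coboundary has a source at the first face and a sink at the last. *)
Fixpoint path_flux f (q : seq {set V}) : cochain R V :=
  if q is f' :: r then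
    s f (f :&: f') *: elementary R (f :&: f') + path_flux f' r
  else 0.

Lemma path_flux_supp f q x : path (gadj T0) f q ->
  (forall u v, u \in f :: q -> v \in f :: q -> gadj T0 u v -> x != u :&: v) ->
  path_flux f q x = 0.
Proof.
elim: q f => [|f' r IH] f /=; first by rewrite ffunE.
move=> /andP[ff' f'r] xN; rewrite !ffunE IH //; last first.
  by move=> u v uf vf; apply: xN; rewrite inE ?uf ?vf orbT.
by rewrite (negbTE (xN _ _ _ _ ff')) ?inE ?eqxx ?orbT // scaler0 addr0.
Qed.

Lemma path_flux_tree f q x : path (gadj T0) f q -> x \notin tree_edges ->
  path_flux f q x = 0.
Proof.
move=> fq xT; apply: path_flux_supp => // u v _ _ uv.
by apply: contraNneq xT => ->; have [] := gadj_tree uv.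
Qed.

(** By [osign_tree] a crossed edge contributes 1 at the face left and -1 at the face entered, so the
    sum telescopes. *)
Lemma coboundary_path_flux f q g : path (gadj T0) f q -> g \in faces K ->
  omega g * d (path_flux f q) g = (g == f)%:R - (g == last f q)%:R.
Proof.
move=> + gF; elim: q f => [|f' r IH] f /=.
  by move=> _; rewrite linear0 ffunE mulr0 subrr.
move=> /andP[ff' f'r]; rewrite linearD linearZ ffunE mulrDr IH // ffunE.
rewrite -[RHS](subrKA (g == f')%:R); congr (_ + _).
have [eT ce fF f'F] := gadj_tree ff'; have eE := tree_edge_edge eT.
rewrite coboundary_elementary // /GRing.scale /= mulrCA -/(s g _).
have ffN : f != f' by case/andP: ff'.
have [->|gf] := eqVneq g f.
  by rewrite osign_sq ?subsetIl // (negbTE ffN) subr0.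
have [->|gf'] := eqVneq g f'.
  by rewrite osign_tree // mulrN osign_sq ?subsetIl // sub0r.
rewrite /s (incidence_notin R oK gF eE) ?mulr0 ?subrr //.
apply: contraT; rewrite negbK => eg.
have : g \in cofaces K (f :&: f') by rewrite inE gF.
by rewrite ce !inE (negbTE gf) (negbTE gf').
Qed.

(** Coherence of omega makes [s f e * z e] the same at every entry into a face, so the crossed edges
    receive minus this constant times [path_flux]. The last assignment stays outermost because e'
    may be the starting edge, whose value it then overwrites. *)
Lemma transport_alongE z e e' f q : path (gadj T0) f q -> uniq (f :: q) ->
  f \in faces K -> e \in edges K -> e \subset f ->
  (forall u v, u \in f :: q -> v \in f :: q -> gadj T0 u v ->
     z (u :&: v) = 0) ->
  transport_along o z e (f :: q) e' =
  assign (z - (s f e * z e) *: path_flux f q) e'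
    (- (s f e * z e) * s (last f q) e').
Proof.
elim: q f e z => [|f' r IH] f e z fq fU fF eE ef z0.
  rewrite /= scaler0 subr0; congr assign.
  have sq := incidence_sq R oK fF eE ef.
  have incV : (inc f e)^-1 = inc f e.
    exact: mulr1_eq.
  rewrite incV /s; have := omega_sq f; set a := omega f; set b := inc f e.
  by move=> aa; rewrite -[LHS]mul1r -aa; ring.
case/andP: (fq) => ff' f'r; case/andP: (fU) => fN rU.
have [e1T ce1 _ f'F] := gadj_tree ff'.
rewrite -[LHS]/(transport_along o (assign z (f :&: f')
  (- (inc f (f :&: f') / inc f e) * z e)) (f :&: f') (f' :: r) e').
rewrite [last _ _]/= [path_flux _ _]/=.
set e1 := f :&: f' in e1T ce1 *; have e1E := tree_edge_edge e1T.
have ze1 : z e1 = 0 by apply: z0 => //; rewrite !inE eqxx ?orbT.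
(* No later crossing hits [e1] again: one of its two cofaces is f, which does not recur on the
   path. *)
have e1N u v : u \in f' :: r -> v \in f' :: r -> gadj T0 u v -> u :&: v != e1.
  move=> uq vq uv; apply: contraNneq fN => uve1.
  have [_ cuv _ _] := gadj_tree uv.
  have : f \in [set u; v] by rewrite -cuv uve1 ce1 set21.
  by case/set2P=> ->.
rewrite IH ?subsetIr //; last first.
  move=> u v uq vq uv; rewrite ffunE (negbTE (e1N _ _ uq vq uv)).
  by apply: z0; rewrite ?[_ \in f :: _]in_cons ?uq ?vq ?orbT.
have sq := incidence_sq R oK fF eE ef.
have sq1 := incidence_sq R oK fF e1E (subsetIl _ _).
have incV : (inc f e)^-1 = inc f e.
  exact: mulr1_eq.
rewrite [assign _ _ _ e1]ffunE eqxx osign_tree //.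
set th := s f e * z e.
have -> : - s f e1 * (- (inc f e1 / inc f e) * z e) = th.
  rewrite incV /th /s; rewrite -/e1 in sq1.
  move: sq1; set a := inc f e1 => aa.
  transitivity ((a * a) * (omega f * inc f e * z e)); first by ring.
  by rewrite aa mul1r.
congr assign; apply/ffunP => x; rewrite !ffunE -/e1.
have [->|xe1] := eqVneq x e1; last first.
  by rewrite scaler0 add0r.
rewrite (path_flux_supp f'r) => [|u v uq vq uv]; last first.
  by rewrite eq_sym e1N.
rewrite ze1 scaler0 subr0 addr0 sub0r /GRing.scale /= mulr1 /th incV /s.
move: (omega_sq f); set a := omega f => aa.
by rewrite -[LHS]mul1r -aa; ring.
Qed.

Definition tree_flux f f' : cochain R V :=
  path_flux f (behead (tree_path Tt f f')).

Lemma tree_flux_supp f f' x : f \in faces K -> f' \in faces K ->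
  x \notin tree_edges -> tree_flux f f' x = 0.
Proof.
move=> fF f'F xT; rewrite /tree_flux.
have [q [-> fq _ _]] := tree_pathP fF f'F.
exact: path_flux_tree.
Qed.

Lemma coboundary_tree_flux f f' g : f \in faces K -> f' \in faces K ->
  g \in faces K ->
  omega g * d (tree_flux f f') g = (g == f)%:R - (g == f')%:R.
Proof.
move=> fF f'F gF; rewrite /tree_flux.
have [q [-> fq <- _]] := tree_pathP fF f'F.
exact: coboundary_path_flux.
Qed.

(** With distinct end edges the failure test never succeeds, since the final value is, up to sign, a
    product of two signs. *)
Lemma transportE f f' e e' : f \in faces K -> f' \in faces K ->
  e \in edges K -> e \subset f -> e \notin tree_edges ->
  e' \in edges K -> e' \subset f' -> e' \notin tree_edges -> e != e' ->
  transport R o (tree_path Tt f f') e e' =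
  elementary R e - s f e *: (tree_flux f f' + s f' e' *: elementary R e').
Proof.
move=> fF f'F eE ef eT e'E e'f e'T ee'.
have P0 := tree_flux_supp fF f'F e'T; move: P0; rewrite /tree_flux.
have [q [-> fq lq fU]] := tree_pathP fF f'F.
rewrite [behead _]/= => P0.
rewrite /transport transport_alongE //; last first.
  move=> u v _ _ uv; rewrite !ffunE; case: eqP => // uve.
  by move: eT; rewrite -uve; have [->] := gadj_tree uv.
rewrite [assign _ _ _ e]ffunE eqxx mulr1 lq.
rewrite [assign _ _ _ e']ffunE eqxx (negbTE ee') /= orbF.
have s2 := osign_sq fF eE ef; have s2' := osign_sq f'F e'E e'f.
rewrite mulf_eq0 oppr_eq0 -[_ || _]/(_ || _).
have -> : (s f e == 0) = false.
  by apply: contra_eqF s2 => /eqP ->; rewrite mul0r eq_sym oner_eq0.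
have -> : (s f' e' == 0) = false.
  by apply: contra_eqF s2' => /eqP ->; rewrite mul0r eq_sym oner_eq0.
apply/ffunP => x; rewrite !ffunE.
have [->|xe'] := eqVneq x e'.
  by rewrite eq_sym (negbTE ee') P0 /GRing.scale /= mulr1; ring.
by rewrite /= scaler0 addr0; case: eqP.
Qed.

(** The value brought back to e is [- s f e * s f' e], which agrees with the initial 1 exactly when
    the two signs are opposite. *)
Lemma transport_loop f f' e : f \in faces K -> f' \in faces K ->
  e \in edges K -> e \subset f -> e \subset f' -> e \notin tree_edges ->
  transport R o (tree_path Tt f f') e e =
  if s f e + s f' e == 0 then elementary R e - s f e *: tree_flux f f' else 0.
Proof.
move=> fF f'F eE ef ef' eT.
have P0 := tree_flux_supp fF f'F eT; move: P0; rewrite /tree_flux.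
have [q [-> fq lq fU]] := tree_pathP fF f'F.
rewrite [behead _]/= => P0.
rewrite /transport transport_alongE //; last first.
  move=> u v _ _ uv; rewrite !ffunE; case: eqP => // uve.
  by move: eT; rewrite -uve; have [->] := gadj_tree uv.
have -> : assign (0 : cochain R V) e 1 e = 1 by rewrite ffunE eqxx.
rewrite mulr1 lq [assign _ _ _ e]ffunE eqxx /=.
have s2 := osign_sq fF eE ef; have s2' := osign_sq f'F eE ef'.
have -> : (- s f e * s f' e == 0) = false.
  rewrite mulf_eq0 oppr_eq0; apply/negP => /orP[] /eqP s0.
    by move: s2; rewrite s0 mul0r => /esym/eqP; rewrite oner_eq0.
  by move: s2'; rewrite s0 mul0r => /esym/eqP; rewrite oner_eq0.
have -> : (- s f e * s f' e != 1) = (s f e + s f' e != 0).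
  congr (~~ _); apply/eqP/eqP => [ss|/eqP]; last first.
    by rewrite addrC addr_eq0 => /eqP ->; rewrite mulrNN.
  have -> : s f e = - (- s f e * s f' e) * s f' e.
    by rewrite !mulNr opprK -mulrA s2' mulr1.
  by rewrite ss mulN1r addNr.
case: eqP => //= ss; apply/ffunP => x; rewrite !ffunE.
have [->|xe] := eqVneq x e; last by [].
rewrite P0 scaler0 subr0; move/eqP: ss.
by rewrite addrC addr_eq0 => /eqP ->; rewrite mulrNN s2.
Qed.

(** * The loops as explicit relative cocycles *)

Variables (f1 f2 : {set V} -> {set V}) (Kc : {set {set V}}).
Hypothesis labels : face_labels K f1 f2.
Hypothesis Kc_bd : Kc \subset bd K.
Local Notation M := (Defs.EM K ET Tt).
Local Notation II := (EMII R K o ET Tt f1 f2).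
Local Notation flux := tree_flux.
Local Notation Z1 := (rel_cocycles1 R K Kc o).
Local Notation C0 := (rel_cochains R K Kc 0).
Local Notation B1 := (rel_coboundaries1 R K Kc o).
Local Notation L := (bd K :\: Kc).

Lemma coboundaryE_fun z : coboundary R K o z = d z.
Proof. by rewrite lfunE. Qed.

Lemma internal_rel e :
  e \in edges K -> e \notin bd_edges K -> e \in edges K :\: Kc.
Proof.
move=> eE eB; rewrite in_setD eE andbT; apply: contra eB => eKc.
have /orP[//|] := bd_cells KS (subsetP Kc_bd _ eKc).
by move: eE; rewrite !inE => /andP[_ /eqP ->]; rewrite andbF.
Qed.

Lemma rel_cocycles1P z :
  reflect ((forall x, x \notin edges K :\: Kc -> z x = 0) /\
           forall f, f \in faces K -> d z f = 0)
          (z \in Z1).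
Proof.
rewrite memv_cap memv_ker coboundaryE_fun.
apply: (iffP andP) => [[/rel_cochainsP z0 /eqP dz]|[z0 dz]].
  by split=> // f _; rewrite dz ffunE.
split; first exact/rel_cochainsP.
apply/eqP/ffunP => x; rewrite [RHS]ffunE.
have [/dz //|xF] := boolP (x \in faces K).
apply: (coboundary_supp oK _ xF) => t tE; apply: z0.
by rewrite in_setD (negbTE tE) andbF.
Qed.

(** The coboundary after each face f has been reoriented by [omega f]; it has the same zeros, and
    sources and sinks of fluxes appear in it with coefficients 1 and -1. *)
Definition wd f z : R := omega f * d z f.

Lemma wdD f z z' : wd f (z + z') = wd f z + wd f z'.
Proof. by rewrite /wd linearD ffunE mulrDr. Qed.

Lemma wdB f z z' : wd f (z - z') = wd f z - wd f z'.
Proof. by rewrite /wd linearB !ffunE mulrBr. Qed.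

Lemma wdZ f (a : R) z : wd f (a *: z) = a * wd f z.
Proof. by rewrite /wd linearZ ffunE mulrCA. Qed.

Lemma wd_elem f e : f \in faces K -> e \in edges K ->
  wd f (elementary R e) = s f e.
Proof. by move=> fF eE; rewrite /wd coboundary_elementary. Qed.

Lemma wd_flux f f' g : f \in faces K -> f' \in faces K -> g \in faces K ->
  wd g (flux f f') = (g == f)%:R - (g == f')%:R.
Proof. exact: coboundary_tree_flux. Qed.

Lemma osign0 f e : f \in faces K -> e \in edges K -> f \notin cofaces K e ->
  s f e = 0.
Proof.
move=> fF eE fe; rewrite /osign (incidence_notin R oK fF eE) ?mulr0 //.
by apply: contra fe => ef; rewrite inE fF.
Qed.

Lemma wd_internal e a b f : e \in edges K -> cofaces K e = [set a; b] ->
  a != b -> f \in faces K ->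
  wd f (elementary R e) = (f == a)%:R * s a e + (f == b)%:R * s b e.
Proof.
move=> eE ce ab fF; rewrite wd_elem //.
have [->|fa] := eqVneq f a; first by rewrite (negbTE ab) mul1r mul0r addr0.
have [->|fb] := eqVneq f b; first by rewrite mul0r mul1r add0r.
by rewrite !mul0r addr0 osign0 // ce !inE negb_or fa.
Qed.

Lemma wd_bd e a f : e \in edges K -> cofaces K e = [set a] ->
  f \in faces K -> wd f (elementary R e) = (f == a)%:R * s a e.
Proof.
move=> eE ce fF; rewrite wd_elem //.
have [->|fa] := eqVneq f a; first by rewrite mul1r.
by rewrite mul0r osign0 // ce inE.
Qed.

Lemma cocycle_intro z :
  (forall x, x \notin edges K :\: Kc -> z x = 0) ->
  (forall f, f \in faces K -> wd f z = 0) -> z \in Z1.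
Proof.
move=> z0 wz; apply/rel_cocycles1P; split=> // f fF.
by rewrite -[LHS]mul1r -(omega_sq f) -mulrA -/(wd f z) wz ?mulr0.
Qed.

Lemma cocycle_wd z f :
  z \in Z1 -> f \in faces K -> wd f z = 0.
Proof. by move=> /rel_cocycles1P[_ dz] fF; rewrite /wd dz ?mulr0. Qed.

Lemma EM_labels e : e \in M ->
  [/\ e \in edges K, e \notin tree_edges,
      cofaces K e = [set f1 e; f2 e] & f1 e != f2 e].
Proof.
move=> eM; have [eE eB _ eT] := EM_edge eM.
have ce := labels eE eB; split=> //; have := cofaces_internal KS eE eB.
by rewrite ce cards2; case: eqP.
Qed.

Lemma label_coface e : e \in M ->
  (f1 e \in cofaces K e) /\ (f2 e \in cofaces K e).
Proof. by case/EM_labels => _ _ -> _; rewrite set21 set22. Qed.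

Lemma label_face e : e \in M ->
  [/\ f1 e \in faces K, f2 e \in faces K, e \subset f1 e & e \subset f2 e].
Proof. by case/label_coface => /cofaceP[? ?] /cofaceP[? ?]. Qed.

Lemma handle_loopE e : e \in M -> handle_loop R o Tt f1 f2 e =
  if s (f1 e) e + s (f2 e) e == 0
  then elementary R e - s (f1 e) e *: flux (f1 e) (f2 e) else 0.
Proof.
move=> eM; have [eE eT ce f12] := EM_labels eM.
have [f1F f2F ef1 ef2] := label_face eM.
exact: transport_loop.
Qed.

Lemma osign_M e : e \in M ->
  s (f1 e) e * s (f1 e) e = 1 /\ s (f2 e) e * s (f2 e) e = 1.
Proof.
move=> eM; have [eE _ _ _] := EM_labels eM; have [c1 c2] := label_coface eM.
by split; apply: osign_sq_coface.
Qed.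

Lemma EMII_M e : e \in II -> e \in M.
Proof. by rewrite inE => /andP[]. Qed.

(** A loop that does not fail takes the value 1 at e, so it is zero only through failure. *)
Lemma mem_EMII e : e \in M -> (e \in II) = (s (f1 e) e + s (f2 e) e != 0).
Proof.
move=> eM; rewrite in_set eM /= handle_loopE //.
have [ss|ss] := eqVneq (s (f1 e) e + s (f2 e) e) 0; last by rewrite eqxx.
apply/negbTE/eqP => /ffunP/(_ e); have [_ eT _ _] := EM_labels eM.
have [f1F f2F _ _] := label_face eM.
rewrite !ffunE eqxx tree_flux_supp // scaler0 subr0 => /eqP;
  exact/negP/oner_neq0.
Qed.

Lemma EMII_osign e : e \in II -> s (f2 e) e = s (f1 e) e.
Proof.
move=> eII; have eM := EMII_M eII; rewrite mem_EMII // in eII.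
have [s1 s2] := osign_M eM; move: eII; rewrite addr_eq0.
set a := s _ _ in s1 *; set b := s _ _ in s2 * => ab.
have : (b - a) * (a + b) == 0.
  by rewrite [a + b]addrC -subr_sqr !expr2 s1 s2 subrr.
by rewrite mulf_eq0 [a + b == 0]addr_eq0 (negbTE ab) orbF subr_eq0 => /eqP.
Qed.

Lemma elem0 e x : x != e -> elementary R e x = 0.
Proof. by move=> xe; rewrite ffunE (negbTE xe). Qed.

Lemma notin_tree x : x \notin edges K :\: Kc -> x \notin tree_edges.
Proof.
apply: contra => xT.
by rewrite internal_rel ?(tree_edge_edge xT) ?(tree_edge_internal xT).
Qed.

Lemma M_rel e : e \in M -> e \in edges K :\: Kc.
Proof. by case/EM_edge => eE eB _ _; apply: internal_rel. Qed.

Lemma handle_loop_cocycle e : e \in M ->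
  handle_loop R o Tt f1 f2 e \in Z1.
Proof.
move=> eM; rewrite handle_loopE //.
have [ss|_] := eqVneq (s (f1 e) e + s (f2 e) e) 0; last exact: mem0v.
have [eE eT ce f12] := EM_labels eM; have [f1F f2F _ _] := label_face eM.
apply: cocycle_intro => [x xK|f fF].
  have xe : x != e by apply: contraNneq xK => ->; apply: M_rel.
  by rewrite !ffunE (negbTE xe) tree_flux_supp ?notin_tree // scaler0 subrr.
rewrite wdB wdZ wd_flux // (wd_internal eE ce) //.
have -> : s (f2 e) e = - s (f1 e) e by apply/eqP; rewrite -addr_eq0 addrC ss.
by ring.
Qed.

(** At e and at es the two transports agree, because each of these edges is seen with the same sign
    from its two faces; the definition therefore counts them once there, while the two fluxes add
    up. *)
Lemma paired_handle_loopE es e : es \in II -> e \in II -> e != es ->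
  paired_handle_loop R o Tt f1 f2 es e =
  elementary R e - s (f1 e) e *:
    (flux (f1 e) (f1 es) + flux (f2 e) (f2 es)
     + s (f1 es) es *: elementary R es).
Proof.
move=> esII eII ees; have [esM eM] := (EMII_M esII, EMII_M eII).
have [eE eT ce f12] := EM_labels eM; have [f1F f2F ef1 ef2] := label_face eM.
have [esE esT ces f12s] := EM_labels esM.
have [f1sF f2sF esf1 esf2] := label_face esM.
apply/ffunP => x; rewrite ffunE.
rewrite !transportE //.
rewrite !EMII_osign // !ffunE !inE.
have [->|xe] := eqVneq x e.
  by rewrite !tree_flux_supp // (negbTE ees) /= scaler0 !addr0 scaler0 subr0.
have [->|xes] := eqVneq x es; first by rewrite !tree_flux_supp // !add0r.
by rewrite /GRing.scale /=; ring.
Qed.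

(** The value 1 on e feeds both faces of e with the same sign. The two fluxes carry this to the two
    faces of es, where the single value on es absorbs both. *)
Lemma paired_handle_loop_cocycle es e : es \in II -> e \in II -> e != es ->
  paired_handle_loop R o Tt f1 f2 es e \in Z1.
Proof.
move=> esII eII ees; rewrite paired_handle_loopE //.
have [esM eM] := (EMII_M esII, EMII_M eII).
have [eE eT ce f12] := EM_labels eM; have [f1F f2F _ _] := label_face eM.
have [esE esT ces f12s] := EM_labels esM.
have [f1sF f2sF _ _] := label_face esM.
apply: cocycle_intro => [x xK|f fF].
  have xe : x != e by apply: contraNneq xK => ->; apply: M_rel.
  have xes : x != es by apply: contraNneq xK => ->; apply: M_rel.
  rewrite !ffunE (negbTE xe) (negbTE xes) !tree_flux_supp ?notin_tree //.
  by rewrite /= scaler0 !addr0 scaler0 subrr.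
rewrite wdB wdZ !wdD wdZ !wd_flux // (wd_internal eE ce) //.
rewrite (wd_internal esE ces) // !EMII_osign //.
have [sse _] := osign_M eM; have [sss _] := osign_M esM.
set a := s (f1 e) e in sse *; set b := s (f1 es) es in sss *.
rewrite -[X in X + _ - _]mulr1 -[X in _ + X - _]mulr1.
have -> : forall p q : R, b * (p * b + q * b) = p + q.
  by move=> p q; rewrite -mulrDl mulrCA sss mulr1.
by ring.
Qed.

Lemma incident_faceP e : e \in bd_edges K ->
  cofaces K e = [set incident_face K e].
Proof.
rewrite bd_edgesE => /andP[_ /cards1P[h ch]].
rewrite /incident_face ch; case: pickP => [f|/(_ h)] /=.
  by rewrite inE => /eqP ->.
by rewrite inE eqxx.
Qed.

Lemma incident_face_face e : e \in bd_edges K ->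
  (incident_face K e \in faces K) /\ (e \subset incident_face K e).
Proof. by move=> eB; apply: cofaceP; rewrite (incident_faceP eB) set11. Qed.

Lemma bd_notin_tree e : e \in bd_edges K -> e \notin tree_edges.
Proof. by apply: contraTN => /tree_edge_internal. Qed.

Lemma osign_bd e : e \in bd_edges K ->
  s (incident_face K e) e * s (incident_face K e) e = 1.
Proof.
move=> eB; have [iF ei] := incident_face_face eB.
exact: (osign_sq iF (bd_edge_edge eB) ei).
Qed.

Lemma contact_loopE eh ej : eh \in bd_edges K -> ej \in bd_edges K ->
  ej != eh ->
  contact_loop R K o Tt eh ej =
  elementary R ej - s (incident_face K ej) ej *:
    (flux (incident_face K ej) (incident_face K eh)
     + s (incident_face K eh) eh *: elementary R eh).
Proof.
move=> hB jB jh; have [hF hi] := incident_face_face hB.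
have [jF ji] := incident_face_face jB.
apply: transportE => //.
- exact: bd_edge_edge.
- exact: bd_notin_tree.
- exact: bd_edge_edge.
- exact: bd_notin_tree.
Qed.

Lemma contact_loop_cocycle eh ej : eh \in bd_edges K -> ej \in bd_edges K ->
  ej != eh -> eh \notin Kc -> ej \notin Kc ->
  contact_loop R K o Tt eh ej \in Z1.
Proof.
move=> hB jB jh hKc jKc; rewrite contact_loopE //.
have [hF hi] := incident_face_face hB.
have [jF ji] := incident_face_face jB.
have [hE jE] := (bd_edge_edge hB, bd_edge_edge jB).
apply: cocycle_intro => [x xK|f fF].
  have xh : x != eh by apply: contraNneq xK => ->; rewrite in_setD hKc.
  have xj : x != ej by apply: contraNneq xK => ->; rewrite in_setD jKc.
  rewrite !ffunE (negbTE xh) (negbTE xj) tree_flux_supp ?notin_tree //.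
  by rewrite /= scaler0 !addr0 scaler0 subrr.
rewrite wdB wdZ wdD wdZ wd_flux // (wd_bd jE (incident_faceP jB)) //.
rewrite (wd_bd hE (incident_faceP hB)) // [s _ eh * _]mulrCA osign_bd //.
by ring.
Qed.

(** Both fluxes leave through the only face of eh, so eh carries 2, while es absorbs one flux on
    each of its faces with a single value. *)
Lemma twisted_contact_loopE es eh : es \in II -> eh \in bd_edges K ->
  twisted_contact_loop R K o Tt f1 f2 es eh =
  elementary R eh *+ 2 - s (incident_face K eh) eh *:
    (flux (incident_face K eh) (f1 es) + flux (incident_face K eh) (f2 es)
     + s (f1 es) es *: elementary R es).
Proof.
move=> esII hB; have esM := EMII_M esII.
have [esE esT ces f12s] := EM_labels esM.
have [f1sF f2sF esf1 esf2] := label_face esM.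
have [hF hi] := incident_face_face hB; have hE := bd_edge_edge hB.
have hT := bd_notin_tree hB.
have hes : eh != es.
  by apply: contraTneq hB => ->; have [_ ->] := EM_edge esM.
apply/ffunP => x; rewrite ffunE.
rewrite !transportE //.
rewrite EMII_osign // !ffunE.
have [->|xes] := eqVneq x es.
  by rewrite !tree_flux_supp // eq_sym (negbTE hes) !add0r.
by rewrite /GRing.scale /=; ring.
Qed.

Lemma twisted_contact_loop_cocycle es eh : es \in II -> eh \in bd_edges K ->
  eh \notin Kc ->
  twisted_contact_loop R K o Tt f1 f2 es eh \in Z1.
Proof.
move=> esII hB hKc; rewrite twisted_contact_loopE //.
have esM := EMII_M esII.
have [esE esT ces f12s] := EM_labels esM.
have [f1sF f2sF _ _] := label_face esM.
have [hF hi] := incident_face_face hB; have hE := bd_edge_edge hB.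
apply: cocycle_intro => [x xK|f fF].
  have xh : x != eh by apply: contraNneq xK => ->; rewrite in_setD hKc.
  have xes : x != es by apply: contraNneq xK => ->; apply: M_rel.
  rewrite !ffunE (negbTE xh) (negbTE xes) !tree_flux_supp ?notin_tree //.
  by rewrite /= scaler0 !addr0 scaler0 subr0.
rewrite wdB wdZ !wdD wdZ !wd_flux // (wd_bd hE (incident_faceP hB)) //.
rewrite (wd_internal esE ces) // EMII_osign //.
have [sss _] := osign_M esM.
set b := s (f1 es) es in sss *.
have -> : forall p q : R, b * (p * b + q * b) = p + q.
  by move=> p q; rewrite -mulrDl mulrCA sss mulr1.
by ring.
Qed.

(** * Potentials along the spanning tree of the 1-skeleton, and Stokes' formula *)

Hypothesis ETP : handles_tree K ET.
Implicit Types a b : cochain R V.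

Lemma coboundary_eq0 a x y : [set x; y] \in edges K ->
  (d a [set x; y] == 0) = (a [set x] == a [set y]).
Proof.
move=> xyE; have xy : x != y.
  by move: xyE; rewrite inE cards2 => /andP[_]; case: (x != y).
have [xyo|xyo] := edge_orient2 oK xy (cells_sub xyE);
  rewrite (coboundary_edge Kcx oK _ xyE xyo) subr_eq0 // eq_sym.
Qed.

Lemma ET_edge e : e \in ET -> e \in edges K.
Proof. by have [[/subsetP sub _] _] := ETP; apply: sub. Qed.

Lemma ET_potential z : exists a : cochain R V,
  (forall t, t \notin cells K 0 -> a t = 0) /\
  (forall e, e \in ET -> d a e = z e).
Proof.
have [[_ ETt] _] := ETP.
(* [dz x y] is z read along the edge from x to y, with a sign when the edge is oriented the other
   way. *)
pose dz x y := if o [set x; y] == [:: x; y] then z [set x; y]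
               else - z [set x; y].
have [A AP] : exists A : V -> R, forall x y, gadj ET x y -> A y = A x + dz x y.
  apply: (tree_potential (k := fun x y t => t + dz x y) 0 ETt) => x y t.
  case/andP=> xy /ET_edge xyE; rewrite /dz [[set y; x]]setUC.
  have yx : ([:: x; y] == [:: y; x]) = false by rewrite eqseq_cons (negbTE xy).
  have xy' : ([:: y; x] == [:: x; y]) = false by rewrite eq_sym.
  have [->|->] := edge_orient2 oK xy (cells_sub xyE);
    by rewrite eqxx ?yx ?xy' ?addrK ?addrNK.
(* The nodes of the complex are singletons, on which the sum over t merely reads off [A]. *)
exists [ffun t => if t \in cells K 0 then \sum_(v in t) A v else 0].
split=> [t|e eET]; first by rewrite ffunE => /negbTE ->.
have eE := ET_edge eET; have [x [y [eo xy eE']]] := edge_orient oK eE.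
have vK v : [set v] \in cells K 0 by rewrite inE (node_cell Kcx) cards1.
rewrite (coboundary_edge Kcx oK _ eE eo) !ffunE !vK !big_set1.
have -> : A y = A x + dz x y by apply: AP; rewrite /gadj xy -eE'.
by rewrite /dz -eE' eo eqxx addrC addKr.
Qed.

Lemma ET_const a : (forall e, e \in ET -> d a e = 0) ->
  forall x y, a [set x] = a [set y].
Proof.
move=> a0 x y; have [[_ [_ con _]] _] := ETP.
apply: (connected_const (a := fun v => a [set v]) con) => // u v /andP[_ uv].
by apply/eqP; rewrite -coboundary_eq0 ?ET_edge // a0.
Qed.

(** [ET] contains a spanning tree of C, and a is constant along it. *)
Lemma component_const a (C : {set {set V}}) x y :
  (forall e, e \in ET -> e \in bd_edges K -> d a e = 0) ->
  C \in components (bd K) -> x \in nodes C -> y \in nodes C ->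
  a [set x] = a [set y].
Proof.
move=> a0 CB; have [_ /(_ C CB)[S SET [/subsetP SC [gS con _]]]] := ETP.
apply: (connected_const (a := fun v => a [set v]) con) => u v /andP[_ uv].
have uvET := subsetP SET _ uv.
apply/eqP; rewrite -coboundary_eq0 ?ET_edge // a0 //.
have := SC _ uv; rewrite inE => /andP[uvC uv2].
by rewrite -(edges_bd KS) inE uv2 (component_sub CB uvC).
Qed.

Lemma node_adj_bd e v : e \in bd_edges K -> v \in e ->
  cell_adj (bd K) [set v] e /\ cell_adj (bd K) e [set v].
Proof.
move=> eB ve; have prop : [set v] \proper e.
  rewrite properEcard sub1set ve cards1 /=.
  by move: (bd_edge_edge eB); rewrite inE => /andP[_ /eqP ->].
by rewrite /cell_adj (bd_edge_bd eB) (bd_node KS eB ve) prop orbT.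
Qed.

Lemma coboundary_bd_eq0 a :
  (forall e, e \in ET -> e \in bd_edges K -> d a e = 0) ->
  forall e, e \in bd_edges K -> d a e = 0.
Proof.
move=> a0 e eB; have eE := bd_edge_edge eB.
have [C CB eC] := component_exists (bd_edge_bd eB).
have [x [y [_ _ exy]]] := edge_orient oK eE.
have nC v : v \in e -> v \in nodes C.
  move=> ve; rewrite inE; apply: component_adj CB eC _.
  by have [] := node_adj_bd eB ve.
apply/eqP; rewrite exy in eE nC *; rewrite coboundary_eq0 //; apply/eqP.
by apply: (component_const a0 CB); rewrite nC ?inE ?eqxx ?orbT.
Qed.

Lemma sum_osign_pair e f f' :
  cofaces K e = [set f; f'] -> f != f' ->
  \sum_(g in cofaces K e) s g e = s f e + s f' e.
Proof.
by move=> -> ff'; rewrite big_setU1 ?inE //= big_set1.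
Qed.

Lemma sum_osign_tree e : e \in tree_edges ->
  \sum_(f in cofaces K e) s f e = 0.
Proof.
move=> eT; have [f [f' [ff' ce eI]]] := tree_edgeP eT.
rewrite (sum_osign_pair ce).
  by rewrite -eI osign_tree // subrr.
by case/andP: ff'.
Qed.

Lemma sum_osign_M e : e \in M ->
  \sum_(f in cofaces K e) s f e = s (f1 e) e + s (f2 e) e.
Proof.
move=> eM; have [_ _ ce f12] := EM_labels eM.
exact: sum_osign_pair.
Qed.

(** Adding the closedness conditions of all faces weights each edge by the sum of the signs of its
    faces, which vanishes wherever omega is coherent. *)
Lemma stokes z : (forall f, f \in faces K -> wd f z = 0) ->
  \sum_(e in edges K) z e * \sum_(f in cofaces K e) s f e = 0.
Proof.
move=> wz; rewrite -(sum_coboundary oK omega z) big1 //; exact: wz.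
Qed.

(** Off [ET] this is the construction of omega on tree edges and the emptiness of [II] on E_M. For e
    in [ET], apply [stokes] to the coboundary of a potential that is 1 on e and 0 on the rest of
    [ET]: it vanishes on the boundary, and e alone survives in the sum. *)
Lemma coherent_internal e : II = set0 ->
  e \in edges K -> e \notin bd_edges K ->
  \sum_(f in cofaces K e) s f e = 0.
Proof.
move=> II0 eE eB; have [eET|eET] := boolP (e \in ET); last first.
  have /orP[eT|eM] := edge_cases eE eB eET; first exact: sum_osign_tree.
  rewrite sum_osign_M //; apply/eqP/contraT.
  by rewrite -mem_EMII // II0 inE.
have [a [_ aET]] := ET_potential (elementary R e).
have da0 : forall e', e' \in bd_edges K -> d a e' = 0.
  apply: coboundary_bd_eq0 => e' e'ET e'B; rewrite aET // elem0 //.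
  by apply: contraNneq eB => <-.
have := stokes (z := d a).
have wz f : f \in faces K -> wd f (d a) = 0.
  by move=> fF; rewrite /wd (coboundary_coboundary Kcx oK) ?mulr0.
move/(_ wz); rewrite (bigD1 e) //= [X in _ + X]big1 ?addr0; last first.
  move=> e' /andP[e'E e'e]; have [e'B|e'B] := boolP (e' \in bd_edges K).
    by rewrite da0 // mul0r.
  have [e'ET|e'ET] := boolP (e' \in ET).
    by rewrite aET // elem0 // mul0r.
  have /orP[eT|eM] := edge_cases e'E e'B e'ET.
    by rewrite sum_osign_tree // mulr0.
  rewrite sum_osign_M //; suff -> : s (f1 e') e' + s (f2 e') e' = 0.
    by rewrite mulr0.
  apply/eqP/contraT.
  by rewrite -mem_EMII // II0 inE.
by rewrite aET // ffunE eqxx mul1r.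
Qed.

(* Weighting the faces by omega times the indicator of one side of the cut
   that the removal of e makes in the dual tree isolates z e. *)
Lemma tree_supported_eq0 z :
  (forall f, f \in faces K -> wd f z = 0) ->
  (forall x, x \notin tree_edges -> z x = 0) -> z = 0.
Proof.
move=> wz zT; apply/ffunP => e; rewrite [RHS]ffunE.
have [eT|/zT //] := boolP (e \in tree_edges).
have [g [g' [gg' ce eI]]] := tree_edgeP eT.
have [_ T0t] := T0P; have ng : g != g' by case/andP: gg'.
pose dz x y : R := if x :&: y == e then (if x == g then 1 else -1) else 0.
have [a aP] : exists a : {set V} -> R, forall x y, gadj T0 x y ->
    a y = a x + dz x y.
  apply: (tree_potential (k := fun x y t => t + dz x y) 0 T0t) => x y t xy.
  rewrite /dz [y :&: x]setIC; case: eqP => [xye|_]; last by rewrite !addr0.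
  have [_ cxy _ _] := gadj_tree xy.
  have nxy : x != y by case/andP: xy.
  have : x \in [set g; g'] by rewrite -ce -xye cxy set21.
  have : y \in [set g; g'] by rewrite -ce -xye cxy set22.
  rewrite !inE; move: nxy => /[swap] /orP[] /eqP -> /[swap] /orP[] /eqP ->;
    rewrite ?eqxx //= => _; rewrite eq_sym (negbTE ng) ?addrK ?addrNK //.
have : \sum_(f in faces K) (a f * omega f) * d z f = 0.
  by apply: big1 => f fF; rewrite -mulrA -/(wd f z) wz ?mulr0.
rewrite (sum_coboundary oK) (bigD1 e) ?(tree_edge_edge eT) //=.
have tsum e' f f' : gadj T0 f f' -> cofaces K e' = [set f; f'] ->
    f :&: f' = e' ->
    \sum_(h in cofaces K e') (a h * omega h) * inc h e'
    = - dz f f' * s f e'.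
  move=> ff' ce' eI'; rewrite ce' big_setU1 ?big_set1 /=; last first.
    by rewrite inE; case/andP: ff'.
  rewrite -!mulrA -/(s f e') -/(s f' e') (aP _ _ ff').
  by rewrite -[in s f' _]eI' osign_tree // eI'; ring.
rewrite [X in _ + X]big1 => [|e' /andP[e'E e'e]]; last first.
  have [e'T|/zT ->] := boolP (e' \in tree_edges); last by rewrite mul0r.
  have [f [f' [ff' ce' eI']]] := tree_edgeP e'T.
  by rewrite (tsum _ _ _ ff') // /dz eI' (negbTE e'e) oppr0 mul0r mulr0.
rewrite (tsum _ _ _ gg') // /dz eI !eqxx addr0 mulN1r => /eqP.
rewrite mulf_eq0 => /orP[/eqP //|]; rewrite oppr_eq0 => /eqP s0.
have gc : g \in cofaces K e by rewrite ce set21.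
have := osign_sq_coface (tree_edge_edge eT) gc.
by rewrite s0 mul0r => /esym/eqP; rewrite oner_eq0.
Qed.

(** * Handle loops: values off the dual tree, and generation *)

Definition handle_index es := if II == set0 then M else M :\ es.

Definition handle_generator es e : cochain R V :=
  if e \in II then paired_handle_loop R o Tt f1 f2 es e
  else handle_loop R o Tt f1 f2 e.

Lemma GhaE es :
  Gha R K o ET Tt f1 f2 es =
  [seq handle_generator es e | e <- enum (handle_index es)].
Proof.
rewrite /Gha /handle_index /handle_generator; case: eqP => // II0.
by apply: eq_map => e; rewrite II0 inE.
Qed.

Lemma handle_index_M es e : e \in handle_index es -> e \in M.
Proof. by rewrite /handle_index; case: ifP => // _;
  rewrite in_setD => /andP[]. Qed.

Lemma handle_index_II es e :
  e \in handle_index es -> e \in II -> e != es.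
Proof.
rewrite /handle_index; case: eqP => [->|_ + _]; first by rewrite in_set0.
by rewrite in_setD1 => /andP[].
Qed.

Section Handles.
Variable es : {set V}.
Hypothesis esP : II != set0 -> es \in II.

Let II_ex e : e \in II -> es \in II.
Proof. by move=> eII; apply: esP; apply/set0Pn; exists e. Qed.

Lemma handle_generator_cocycle e :
  e \in handle_index es -> handle_generator es e \in Z1.
Proof.
move=> ei; rewrite /handle_generator; case: ifP => [eII|_].
  apply: paired_handle_loop_cocycle
    => //; [exact: II_ex eII | exact: handle_index_II eII].
apply: handle_loop_cocycle.
exact: handle_index_M ei.
Qed.

(** The fluxes live on tree edges and the only other extra term sits at es. The generators thus
    behave like a dual basis, from which coefficients can be read off. *)
Lemma handle_generatorE e x : e \in handle_index es ->
  x \notin tree_edges -> (II != set0 -> x != es) ->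
  handle_generator es e x = (x == e)%:R.
Proof.
move=> ei xT xes; have eM := handle_index_M ei.
have [f1F f2F _ _] := label_face eM.
rewrite /handle_generator; case: ifP => [eII|eII].
  have esII := II_ex eII; have {}xes : x != es by apply/xes/set0Pn; exists e.
  have [f1sF f2sF _ _] := label_face (EMII_M esII).
  rewrite paired_handle_loopE //.
    rewrite !ffunE (negbTE xes) !tree_flux_supp //.
    by rewrite /= scaler0 !addr0 scaler0 subr0.
  exact: handle_index_II eII.
rewrite handle_loopE //.
move: eII; rewrite mem_EMII //.
move/negbFE ->; rewrite !ffunE tree_flux_supp //.
by rewrite scaler0 subr0.
Qed.

Lemma M_notin e x : e \in M -> (x \in bd_edges K) || (x \in ET) -> x != e.
Proof.
move=> /EM_edge[_ eB eET _] xE; apply: contraTneq xE => ->.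
by rewrite negb_or eB.
Qed.

(** Subtracting each generator with the coefficient [z e] leaves a cocycle supported on the tree
    edges and possibly es; once the value at es is known to be 0, [tree_supported_eq0] applies. *)
Lemma handles_generate z : z \in Z1 ->
  (forall x, x \in bd_edges K -> z x = 0) ->
  (forall x, x \in ET -> z x = 0) ->
  z \in <<Gha R K o ET Tt f1 f2 es>>%VS.
Proof.
move=> zZ zB zET.
pose y := \sum_(e in handle_index es) z e *: handle_generator es e.
have yG : y \in <<Gha R K o ET Tt f1 f2 es>>%VS.
  apply: memv_suml => e ei; apply/memvZ/memv_span.
  by rewrite GhaE; apply: map_f; rewrite mem_enum.
have zyZ : z - y \in Z1.
  apply: memvB => //; apply: memv_suml => e ei; apply/memvZ.
  exact: handle_generator_cocycle.
suff zy0 : z - y = 0 by rewrite -(subrK y z) zy0 add0r.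
have wz f : f \in faces K -> wd f (z - y) = 0.
  by move=> fF; apply: (cocycle_wd zyZ).
have [zy_supp _] := rel_cocycles1P _ zyZ.
have claim x : x \notin tree_edges -> (II != set0 -> x != es) ->
    (z - y) x = 0.
  move=> xT xes; have [xE|xE] := boolP (x \in edges K); last first.
    by apply: zy_supp; rewrite in_setD (negbTE xE) andbF.
  rewrite !ffunE sum_ffunE.
  under eq_bigr => e ei do rewrite ffunE handle_generatorE //.
  have [xi|xi] := boolP (x \in handle_index es).
    rewrite (bigD1 x) //= big1 ?addr0.
      by rewrite eqxx /GRing.scale /= mulr1 subrr.
    by move=> e /andP[_ ex]; rewrite eq_sym (negbTE ex) scaler0.
  rewrite big1 ?subr0; last first.
    move=> e ei; case: eqP => [xe|_]; last by rewrite scaler0.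
    by rewrite xe ei in xi.
  have [/zB //|xB] := boolP (x \in bd_edges K).
  have [/zET //|xET] := boolP (x \in ET).
  have := edge_cases xE xB xET; rewrite (negbTE xT) /= => xM.
  move: xi xes; rewrite /handle_index; case: eqP => [_|II0];
    first by rewrite xM.
  by rewrite in_setD1 xM andbT negbK => /eqP -> /(_ isT); rewrite eqxx.
apply: (tree_supported_eq0 wz) => x xT.
have [II0|II0] := eqVneq II set0.
  by apply: claim; rewrite // II0 eqxx.
have [xes|xes] := eqVneq x es; last exact: claim.
have esII := esP II0; have esM := EMII_M esII.
have [esE _ _ _] := EM_labels esM.
(* Tree edges are coherent and the remaining edges carry 0, so only es is left in the sum; its
   factor is nonzero because es lies in [II]. *)
have := stokes wz; rewrite xes (bigD1 es) //= [X in _ + X]big1 ?addr0.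
  rewrite sum_osign_M // => /eqP; rewrite mulf_eq0.
  move: esII; rewrite mem_EMII //.
  by move=> /negbTE ->; rewrite orbF => /eqP.
move=> e /andP[eE ees]; have [eT|eT] := boolP (e \in tree_edges).
  by rewrite (sum_osign_tree eT) mulr0.
by rewrite claim ?mul0r.
Qed.

Lemma handle_span_supp h x :
  h \in <<Gha R K o ET Tt f1 f2 es>>%VS ->
  (x \in bd_edges K) || (x \in ET) -> h x = 0.
Proof.
move=> hG xE; move: h hG; apply: (@span_ind R _ (fun h : cochain R V => h x =
  0)) => [|a u v u0 v0|u].
- by rewrite ffunE.
- by rewrite !ffunE u0 v0 scaler0 addr0.
rewrite GhaE => /mapP[e]; rewrite mem_enum => ei ->.
have eM := handle_index_M ei.
rewrite handle_generatorE //.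
- by rewrite (negbTE (M_notin eM xE)).
- case/orP: xE => [/bd_notin_tree //|].
  by apply: contraTN => /tree_edge_notin_ET.
- by move=> /esP/EMII_M esM; apply: M_notin.
Qed.

Lemma handle_span_cocycle h :
  h \in <<Gha R K o ET Tt f1 f2 es>>%VS -> h \in Z1.
Proof.
apply: (@span_ind R _ (fun h : cochain R V => h \in Z1)) => [|a u v uZ vZ|u].
- exact: mem0v.
- by apply: memvD; first apply: memvZ.
rewrite GhaE => /mapP[e]; rewrite mem_enum => ei ->.
exact: handle_generator_cocycle.
Qed.

End Handles.

Hypothesis Kc_closed :
  forall s t : {set V}, s \in Kc -> t \subset s -> t != set0 -> t \in Kc.

(** * Boundary edges modulo relative coboundaries *)

Section Contacts.
Variables (Cco : seq {set {set V}}) (sel : {set {set V}} -> {set V}).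
Hypothesis CcoP : numbering L Cco.
Hypothesis selP : contact_edges Cco sel.
Local Notation sels := [seq sel C | C <- Cco].

Lemma Cco_component C : C \in Cco -> C \in components L.
Proof. by case: CcoP => _ <-. Qed.

Lemma sel_in C : C \in Cco -> sel C \in C.
Proof. by move=> /selP; rewrite inE => /andP[]. Qed.

Lemma sel_L C : C \in Cco -> sel C \in L.
Proof. by move=> CC; apply: component_sub (Cco_component CC) (sel_in CC). Qed.

Lemma sel_bd C : C \in Cco -> sel C \in bd_edges K.
Proof.
move=> CC; have := sel_L CC; rewrite in_setD => /andP[_ cB].
rewrite -(edges_bd KS) inE cB.
by have := selP CC; rewrite inE => /andP[].
Qed.

Lemma sel_Kc C : C \in Cco -> sel C \notin Kc.
Proof. by move=> /sel_L; rewrite in_setD => /andP[]. Qed.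

Lemma sel_component C C' : C \in Cco -> C' \in Cco -> sel C \in C' -> C = C'.
Proof.
move=> CC C'C cC'.
exact: component_inj (Cco_component CC) (Cco_component C'C) (sel_in CC) cC'.
Qed.

Lemma sel_eq C C' : C \in Cco -> C' \in Cco -> (sel C == sel C') = (C == C').
Proof.
move=> CC C'C; apply/eqP/eqP => [cc'|-> //].
by apply: sel_component => //; rewrite cc' sel_in.
Qed.

(** Since [Kc] is closed under faces, an edge with a node off [Kc] is itself off [Kc], so adjacency
    in the boundary restricts to [L]. *)
Lemma node_adj e v : e \in bd_edges K -> v \in e -> [set v] \notin Kc ->
  cell_adj L [set v] e /\ cell_adj L e [set v].
Proof.
move=> eB ve vKc; have eKc : e \notin Kc.
  apply: contra vKc => eKc; apply: Kc_closed eKc _ _.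
    by rewrite sub1set.
  by apply/set0Pn; exists v; rewrite set11.
have [] := node_adj_bd eB ve.
by rewrite /cell_adj !in_setD vKc eKc.
Qed.

Lemma coboundary_node v e : e \in edges K ->
  d (elementary R [set v]) e * d (elementary R [set v]) e = (v \in e)%:R.
Proof.
move=> eE; have [x [y [eo xy eE']]] := edge_orient oK eE.
rewrite (coboundary_edge Kcx oK _ eE eo) !ffunE eE' !inE.
rewrite !(inj_eq set1_inj) ![_ == v]eq_sym.
have [->|vx] := eqVneq v x.
  by rewrite (negbTE xy) /= sub0r mulrNN mulr1.
case: eqP => _ /=; rewrite subr0 ?mulr1 ?mulr0 //.
Qed.

Lemma coboundary_scaleB (k l : R) z a x :
  d (k *: z - l *: a) x = k * d z x - l * d a x.
Proof.
have dZ m u : d (m *: u) = m *: d u by exact: linearZ.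
by rewrite linearB /= !dZ; move: (d z) (d a) => u v; rewrite !ffunE.
Qed.

Lemma elementary_rel0 v : [set v] \notin Kc -> elementary R [set v] \in C0.
Proof.
move=> vKc; apply/rel_cochainsP => t tN; rewrite elem0 //.
apply: contraNneq tN => ->; rewrite in_setD vKc.
by rewrite inE (node_cell Kcx) cards1.
Qed.

(* Two boundary edges meeting at a node off Kc differ, up to sign, by the
   coboundary of that node: no third boundary edge contains it. *)
Lemma boundary_edge_reduction C e : C \in Cco -> e \in bd_edges K -> e \in C ->
  exists2 b, b \in C0 &
    forall x, x \in bd_edges K -> x \notin sels -> elementary R e x = d b x.
Proof.
move=> CC + eC; have CL := Cco_component CC.
(* A chain of adjacent cells passes through nodes as well as edges, so the induction needs a
   property of every cell: all boundary edges containing it are reducible. *)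
pose Q (t : {set V}) := forall e, e \in bd_edges K -> t \subset e ->
  exists2 b, b \in C0 &
    forall x, x \in bd_edges K -> x \notin sels -> elementary R e x = d b x.
suff Qe : Q e by move=> eB; apply: Qe.
have card_bd x : x \in bd_edges K -> #|x| = 2%N.
  by move/bd_edge_edge; rewrite inE => /andP[_ /eqP].
have con : connect (cell_adj L) (sel C) e.
  have : e \in [set t in L | connect (cell_adj L) (sel C) t].
    by rewrite -(component_connect CL (sel_in CC)).
  by rewrite inE => /andP[].
apply: connect_ind con _; last first.
  move=> e' e'B sub; exists 0; first exact: mem0v.
  have -> : e' = sel C.
    by apply/esym/eqP; rewrite eqEcard sub !card_bd ?sel_bd.
  move=> x xB xS; rewrite linear0 [RHS]ffunE elem0 //.
  by apply: contraNneq xS => ->; apply: map_f.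
move=> t t' /and3P[tL t'L /orP[tt'|t't]] Qt e' e'B sub.
  by apply: Qt => //; apply: subset_trans (proper_sub tt') sub.
have tB : t \in bd_edges K.
  move: tL; rewrite in_setD => /andP[_ /(bd_cells KS) /orP[//|]].
  rewrite inE => /andP[_ /eqP t1]; have := proper_card t't.
  have t'B : t' \in bd K by move: t'L; rewrite in_setD => /andP[].
  rewrite t1 ltnS leqn0 cards_eq0 => /eqP t'0.
  move: t'B; rewrite t'0 inE => /andP[]; have [K0 _ _] := Kcx.
  by rewrite (negbTE K0).
have [e't|e't] := eqVneq e' t; first by apply: Qt; rewrite ?e't.
have [v t'v] : exists v, t' = [set v].
  apply/cards1P; have := proper_card t't; rewrite (card_bd t tB) ltnS.
  move: t'L; rewrite in_setD => /andP[_]; rewrite inE => /andP[t'K _].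
  case c: #|t'| => [|[|]] // _; have [K0 _ _] := Kcx.
  by move: t'K; rewrite (cards0_eq c) (negbTE K0).
have vKc : [set v] \notin Kc by move: t'L; rewrite t'v in_setD => /andP[].
have ve' : v \in e' by rewrite -sub1set -t'v.
have vt : v \in t by rewrite -sub1set -t'v proper_sub.
have at_v x : x \in bd_edges K -> v \in x -> (x == e') || (x == t).
  move=> xB vx; apply: contraT; rewrite negb_or => /andP[xe' xt].
  have [_] := bd_degree KS v; rewrite leqNgt => /negP[].
  have inD y : y \in bd_edges K -> v \in y ->
      y \in [set y in bd_edges K | v \in y].
    by move=> yB vy; rewrite inE; apply/andP.
  have sub3 : x |: [set e'; t] \subset [set y in bd_edges K | v \in y].
    by rewrite !subUset !sub1set !inD.
  apply: leq_trans (subset_leq_card sub3).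
  by rewrite cardsU1 !inE negb_or xe' xt cards2 e't.
have [b bC0 bP] := Qt t tB (subxx _).
pose dv := d (elementary R [set v]).
(* On the boundary [dv] is 1 or -1 at e' and t and 0 elsewhere. Scaling by [dv e'] puts 1 on e', and
   the multiple of b removes what is left on t. *)
exists (dv e' *: elementary R [set v] - (dv e' * dv t) *: b).
  by apply: memvB; apply: memvZ => //; apply: elementary_rel0.
move=> x xB xS; rewrite coboundary_scaleB -/dv -(bP x xB xS) ![elementary _ _
  x]ffunE.
have dv2 y : y \in bd_edges K -> dv y * dv y = (v \in y)%:R.
  by move=> yB; apply: coboundary_node; apply: bd_edge_edge.
have [vx|vx] := boolP (v \in x); last first.
  have xe' : x != e' by apply: contraNneq vx => ->.
  have xt : x != t by apply: contraNneq vx => ->.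
  have /eqP := dv2 x xB; rewrite (negbTE vx) mulf_eq0 orbb => /eqP ->.
  by rewrite (negbTE xe') (negbTE xt) !mulr0 subr0.
case/orP: (at_v x xB vx) => /eqP ->.
  by rewrite eqxx (negbTE e't) dv2 // ve' mulr0 subr0.
by rewrite eq_sym (negbTE e't) eqxx mulr1 subrr.
Qed.

Lemma boundary_reduction z : z \in Z1 ->
  exists2 b, b \in C0 &
    forall x, x \in bd_edges K -> x \notin sels -> z x = d b x.
Proof.
move=> /rel_cocycles1P[z0 _].
(* The existential is stated for every e, with membership as a premise, so that [choice] yields a
   total function. *)
have HB e : exists b, e \in bd_edges K :\: Kc -> b \in C0 /\
    forall x, x \in bd_edges K -> x \notin sels -> elementary R e x = d b x.
  have [eA|_] := boolP (e \in bd_edges K :\: Kc); last by exists 0.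
  move: eA; rewrite in_setD => /andP[eKc eB].
  have eL : e \in L by rewrite in_setD eKc bd_edge_bd.
  have [C CL eC] := component_exists eL.
  have CC : C \in Cco by case: CcoP => _ ->.
  by have [b bC0 bP] := boundary_edge_reduction CC eB eC; exists b.
have /choice[B BP] := HB.
exists (\sum_(e in bd_edges K :\: Kc) z e *: B e).
  by apply: memv_suml => e /BP[? _]; apply: memvZ.
move=> x xB xS; rewrite linear_sum sum_ffunE.
under eq_bigr => e /BP[_ eP] do rewrite linearZ ffunE -eP // ffunE.
have [xKc|xKc] := boolP (x \in Kc).
  rewrite z0 ?in_setD ?xKc // big1 // => e eA.
  have xe : x != e.
    by apply: contraTneq eA => <-; rewrite in_setD xKc.
  by rewrite (negbTE xe) scaler0.
have xA : x \in bd_edges K :\: Kc by rewrite in_setD xKc.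
rewrite (bigD1 x) //= big1 ?addr0; first by rewrite eqxx /GRing.scale /= mulr1.
by move=> e /andP[_ ex]; rewrite eq_sym (negbTE ex) scaler0.
Qed.

(* If d b did not vanish on sel C, the nodes of C sharing the value of b at an
   end point of sel C would be separated from the rest by sel C alone, so that
   the sum of their (even) boundary degrees would be odd. *)
Lemma boundary_independence b C : b \in C0 -> C \in Cco ->
  (forall x, x \in bd_edges K -> x \notin sels -> d b x = 0) ->
  d b (sel C) = 0.
Proof.
move=> bC0 CC b0; have CL := Cco_component CC.
have eB := sel_bd CC; have eE := bd_edge_edge eB.
set e0 := sel C in eB eE *.
have [p [q [_ pq e0E]]] := edge_orient oK eE.
apply/eqP; rewrite {1}e0E coboundary_eq0 -?e0E //.
apply: contraT => bpq.
(* Taking w to be an end point where b is nonzero keeps all nodes of [A] off [Kc], on which b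
   vanishes. *)
have [u [w [bw buw e0uw]]] : exists u w,
    [/\ b [set w] != 0, b [set u] != b [set w] & e0 = [set u; w]].
  have [bq0|bq] := eqVneq (b [set q]) 0; last by exists p, q.
  by exists q, p; split; rewrite ?[b [set q] == _]eq_sym -?bq0 // setUC.
have nKc v : b [set v] != 0 -> [set v] \notin Kc.
  apply: contraNN => vKc; apply/eqP; apply: (rel_cochainsP _ _ _ _ bC0).
  by rewrite in_setD vKc.
pose A := [set v | ([set v] \in C) && (b [set v] == b [set w])].
have wA : w \in A.
  rewrite inE eqxx andbT; apply: component_adj CL (sel_in CC) _.
  have we0 : w \in e0 by rewrite e0uw set22.
  by have [] := node_adj eB we0 (nKc w bw).
have uA : u \notin A by rewrite inE (negbTE buw) andbF.
(* A boundary edge other than [e0] that meets [A] belongs to C, hence is not a selected edge; so b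
   agrees at its two ends and both lie in [A]. *)
have even_e x : x \in bd_edges K -> x != e0 -> ~~ odd #|x :&: A|.
  move=> xB xe0; have xE := bd_edge_edge xB.
  have step v v' : x = [set v; v'] -> v \in A -> v' \in A.
    move=> xvv'; rewrite [in X in X -> _]inE => /andP[vC /eqP bv].
    have vKc : [set v] \notin Kc by apply: nKc; rewrite bv.
    have xC : x \in C.
      apply: component_adj CL vC _.
      have vx : v \in x by rewrite xvv' set21.
      by have [] := node_adj xB vx vKc.
    have bvv' : b [set v] = b [set v'].
      apply/eqP; rewrite -coboundary_eq0 -?xvv' // b0 //.
      apply/mapP => -[C' C'C xC']; case/negP: xe0; rewrite xC' /e0.
      by rewrite sel_eq //; apply/eqP/sel_component; rewrite -?xC'.
    have v'Kc : [set v'] \notin Kc by apply: nKc; rewrite -bvv' bv.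
    rewrite inE -bvv' bv eqxx andbT; apply: component_adj CL xC _.
    have v'x : v' \in x by rewrite xvv' set22.
    by have [] := node_adj xB v'x v'Kc.
  have [v [v' [_ vv' xvv']]] := edge_orient oK xE.
  have step' := step v' v; rewrite setUC in step'.
  have {step} step := step v v' xvv'; have {step'} step' := step' xvv'.
  have [vA|vA] := boolP (v \in A).
    rewrite (_ : x :&: A = x); first by rewrite xvv' cards2 vv'.
    by apply/setIidPl; rewrite xvv' subUset !sub1set vA step.
  rewrite (_ : x :&: A = set0) ?cards0 //; apply/eqP; rewrite setI_eq0.
  have v'A : v' \notin A by apply: contra vA.
  by rewrite xvv' disjoints_subset subUset !sub1set !in_setC vA.
have odd_e0 : odd #|e0 :&: A|.
  rewrite (_ : e0 :&: A = [set w]) ?cards1 //; apply/setP => v.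
  rewrite e0uw in_setI in_set2 in_set1.
  have [->|vw] := eqVneq v w; first by rewrite orbT wA.
  by rewrite orbF; case: eqP => //= ->; rewrite (negbTE uA).
have even_deg v : ~~ odd #|[set x in bd_edges K | v \in x]|.
  by have [] := bd_degree KS v.
have sumE : (\sum_(v in A) #|[set x in bd_edges K | v \in x]| =
             \sum_(x in bd_edges K) #|x :&: A|)%N.
  under eq_bigr => v _.
    rewrite -sum1_card (eq_bigl (fun x => (x \in bd_edges K) && (v \in x)));
      last by move=> x; rewrite inE.
    by rewrite big_mkcondr; over.
  rewrite exchange_big /=; apply: eq_bigr => x _.
  rewrite -big_mkcondr sum1_card; apply: eq_card => v.
  by rewrite unfold_in /= in_setI andbC.
have /(congr1 odd) := sumE.
rewrite (bigD1 e0) //= oddD odd_e0.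
have even_sum (I : finType) (P : pred I) (F : I -> nat) :
    (forall i, P i -> ~~ odd (F i)) -> ~~ odd (\sum_(i | P i) F i)%N.
  move=> PF; apply: (big_ind (fun n => ~~ odd n)) => // m n.
  by rewrite oddD => /negbTE -> /negbTE ->.
have oddL := even_sum _ (mem A) _ (fun v _ => even_deg v).
have oddR : ~~ odd (\sum_(x in bd_edges K | x != e0) #|x :&: A|)%N.
  by apply: even_sum => x /andP[xB xe0]; apply: even_e.
by rewrite (negbTE oddL) (negbTE oddR).
Qed.

End Contacts.

(** * Contact loops: values on the boundary, generation and independence *)

Section Decomposition.
Variables (es_ha es_co : {set V}).
Hypothesis esP : II != set0 -> es_ha \in II /\ es_co \in II.
Variables (Cho Cco : seq {set {set V}}) (sel : {set {set V}} -> {set V}).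
Hypothesis ChoP : numbering (bd K) Cho.
Hypothesis CcoP : numbering L Cco.
Hypothesis selP : contact_edges Cco sel.
Local Notation sels := [seq sel C | C <- Cco].
Local Notation ha := (Gha R K o ET Tt f1 f2 es_ha).
Local Notation ho := (Gho R K o Cho).
Local Notation co := (Gco R K o ET Tt f1 f2 Cco sel es_co).
Local Notation ind := (node_indicator R).
Local Notation loop Cl C := (contact_loop R K o Tt (sel Cl) (sel C)).
Local Notation tloop Cl := (twisted_contact_loop R K o Tt f1 f2 es_co (sel
  Cl)).

Let esh : II != set0 -> es_ha \in II. Proof. by case/esP. Qed.
Let esc : II != set0 -> es_co \in II. Proof. by case/esP. Qed.

(** All contact loops end at the selected edge of the last component, so the list of components is
    always taken apart from its end. *)
Lemma Gco_rcons s0 Cl :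
  Gco R K o ET Tt f1 f2 (rcons s0 Cl) sel es_co =
  let G := [seq loop Cl C | C <- s0] in
  if II == set0 then G else rcons G (tloop Cl).
Proof.
rewrite /Gco; case E: (rcons s0 Cl) => [|C t]; first by case: (s0) E.
by rewrite -E last_rcons size_rcons -cats1 take_size_cat.
Qed.

(** Fluxes run over internal edges, so on the boundary only the two end edges are visible. *)
Lemma contact_loop_bd eh ej x : eh \in bd_edges K -> ej \in bd_edges K ->
  ej != eh -> x \in bd_edges K -> x != eh ->
  contact_loop R K o Tt eh ej x = (x == ej)%:R.
Proof.
move=> hB jB jh xB xh; have [hF _] := incident_face_face hB.
have [jF _] := incident_face_face jB.
rewrite contact_loopE // !ffunE (negbTE xh).
by rewrite tree_flux_supp ?bd_notin_tree //= scaler0 !addr0 scaler0 subr0.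
Qed.

Lemma twisted_contact_loop_bd eh x : II != set0 -> eh \in bd_edges K ->
  x \in bd_edges K ->
  twisted_contact_loop R K o Tt f1 f2 es_co eh x = (x == eh)%:R *+ 2.
Proof.
move=> II0 hB xB; have [hF _] := incident_face_face hB.
have esM := EMII_M (esc II0).
have [f1F f2F _ _] := label_face esM.
have [_ esB _ _] := EM_edge esM.
have xes : x != es_co by apply: contraNneq esB => <-.
rewrite twisted_contact_loopE //;
  last exact: esc.
rewrite !ffunE (negbTE xes) !tree_flux_supp ?bd_notin_tree //=.
by rewrite scaler0 !addr0 scaler0 subr0 -mulr2n.
Qed.

Lemma contact_cocycle c : c \in co -> c \in Z1.
Proof.
case/lastP: (Cco) CcoP selP => [//|s0 Cl] CP sP; rewrite Gco_rcons.
have [uC _] := CP; move: uC; rewrite rcons_uniq => /andP[ClN _].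
have ClC : Cl \in rcons s0 Cl by rewrite mem_rcons mem_head.
have memG : c \in [seq loop Cl C | C <- s0] -> c \in Z1.
  case/mapP => C Cs0 ->.
  have CC : C \in rcons s0 Cl by rewrite mem_rcons in_cons Cs0 orbT.
  apply: contact_loop_cocycle.
  - exact: (sel_bd CP sP ClC).
  - exact: (sel_bd CP sP CC).
  - by rewrite (sel_eq CP sP) //; apply: contraNneq ClN => <-.
  - exact: (sel_Kc CP sP ClC).
  - exact: (sel_Kc CP sP CC).
case: eqP => // /eqP II0; rewrite mem_rcons in_cons => /orP[/eqP ->|//].
apply: twisted_contact_loop_cocycle.
- exact: esc.
- exact: (sel_bd CP sP ClC).
- exact: (sel_Kc CP sP ClC).
Qed.

Lemma span_cocycle (G : seq (cochain R V)) :
  {subset G <= Z1} -> {subset <<G>>%VS <= Z1}.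
Proof. by move=> GZ; apply/subvP/span_subvP. Qed.

Lemma contacts_generate z : z \in Z1 ->
  (forall x, x \in bd_edges K -> x \notin sels -> z x = 0) ->
  exists2 c, c \in <<co>>%VS &
    forall x, x \in bd_edges K -> (z - c) x = 0.
Proof.
have coZ := span_cocycle contact_cocycle.
case/lastP: (Cco) coZ CcoP selP => [|s0 Cl] coZ CP sP zZ z0.
  exists 0; first exact: mem0v.
  by move=> x xB; rewrite subr0 z0.
have [uC _] := CP; move: uC; rewrite rcons_uniq => /andP[ClN us0].
have ClC : Cl \in rcons s0 Cl by rewrite mem_rcons mem_head.
have CC C : C \in s0 -> C \in rcons s0 Cl.
  by move=> Cs0; rewrite mem_rcons in_cons Cs0 orbT.
have hB := sel_bd CP sP ClC.
pose c1 := \sum_(C <- s0) z (sel C) *: loop Cl C.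
have c1G : c1 \in <<[seq loop Cl C | C <- s0]>>%VS.
  rewrite /c1 big_seq; apply: memv_suml => C Cs0.
  by apply/memvZ/memv_span/map_f.
have loopE C x : C \in s0 -> x \in bd_edges K -> x != sel Cl ->
    loop Cl C x = (x == sel C)%:R.
  move=> Cs0 xB xh; apply: contact_loop_bd => //.
    by apply: (sel_bd CP sP); apply: CC.
  by rewrite (sel_eq CP sP (CC _ Cs0) ClC); apply: contraNneq ClN => <-.
have c1x x : x \in bd_edges K -> x != sel Cl -> (z - c1) x = 0.
  move=> xB xh; rewrite !ffunE sum_ffunE big_seq.
  under eq_bigr => C Cs0 do rewrite ffunE loopE //.
  rewrite -big_seq; have [/mapP[C Cs0 xC]|xs] := boolP (x \in [seq sel C | C
    <- s0]).
    rewrite (bigD1_seq C) //= big1_seq ?addr0.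
      by rewrite xC eqxx /GRing.scale /= mulr1 subrr.
    move=> C' /andP[C'C C's0]; rewrite xC (sel_eq CP sP (CC _ Cs0) (CC _
      C's0)).
    by rewrite eq_sym (negbTE C'C) scaler0.
  rewrite big1_seq ?subr0; last first.
    move=> C /andP[_ Cs0]; case: eqP => [xC|_]; last by rewrite scaler0.
    by case/negP: xs; rewrite xC; apply: map_f.
  by apply: z0; rewrite // map_rcons mem_rcons in_cons negb_or xh.
have [II0|II0] := eqVneq II set0.
  have c1co : c1 \in <<Gco R K o ET Tt f1 f2 (rcons s0 Cl) sel es_co>>%VS.
    by rewrite Gco_rcons /= II0 eqxx.
  exists c1 => // x xB; have [->|] := eqVneq x (sel Cl); last exact: c1x.
  have zcZ : z - c1 \in Z1 by apply: memvB => //; apply: coZ.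
  have wz f : f \in faces K -> wd f (z - c1) = 0.
    by move=> fF; apply: (cocycle_wd zcZ).
  (* With [II] empty all internal edges are coherent, and the plain loops have cleared every other
     boundary edge; the value at [sel Cl] remains alone, multiplied by the sign of a single face. *)
  have := stokes wz; rewrite (bigD1 (sel Cl)) ?bd_edge_edge //=.
  rewrite [X in _ + X]big1 ?addr0; last first.
    move=> e /andP[eE eh]; have [eB|eB] := boolP (e \in bd_edges K).
      by rewrite c1x // mul0r.
    rewrite coherent_internal //.
    by rewrite mulr0.
  rewrite (incident_faceP hB) big_set1 => /eqP.
  rewrite mulf_eq0 => /orP[/eqP //|/eqP s0'].
  have := osign_bd hB.
  by rewrite s0' mul0r => /esym/eqP; rewrite oner_eq0.
(* The twisted loop is 2 at [sel Cl] and 0 on the other boundary edges, whence the division by 2. *)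
exists (c1 + ((z - c1) (sel Cl) / 2) *: tloop Cl).
  rewrite Gco_rcons /= (negbTE II0); apply: memvD.
    apply: subvP c1G; apply: sub_span => c cG.
    by rewrite mem_rcons in_cons cG orbT.
  by apply/memvZ/memv_span; rewrite mem_rcons mem_head.
move=> x xB; rewrite opprD addrA.
have -> : forall (u v : cochain R V) (k : R), (u - k *: v) x = u x - k * v x.
  by move=> u v k; rewrite !ffunE.
rewrite twisted_contact_loop_bd //.
have [->|xh] := eqVneq x (sel Cl); last first.
  by rewrite (c1x x xB xh) mulr0n mul0rn mulr0 subr0.
by rewrite divfK ?subrr // pnatr_eq0.
Qed.

Lemma contact_span_bd c x : c \in <<co>>%VS -> x \in bd_edges K ->
  x \notin sels -> c x = 0.
Proof.
case/lastP: (Cco) CcoP selP => [|s0 Cl] CP sP.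
  by rewrite span_nil memv0 => /eqP -> _ _; rewrite ffunE.
move=> cG xB xs; have [uC _] := CP; move: uC.
rewrite rcons_uniq => /andP[ClN us0].
have ClC : Cl \in rcons s0 Cl by rewrite mem_rcons mem_head.
have xC C : C \in rcons s0 Cl -> x != sel C.
  by move=> CC; apply: contraNneq xs => ->; apply: map_f.
move: c cG; apply: (@span_ind R _ (fun c : cochain R V => c x = 0)) => [|a u v
  u0 v0|u].
- by rewrite ffunE.
- by rewrite !ffunE u0 v0 scaler0 addr0.
have memG : u \in [seq loop Cl C | C <- s0] -> u x = 0.
  case/mapP => C Cs0 ->.
  have CC : C \in rcons s0 Cl by rewrite mem_rcons in_cons Cs0 orbT.
  rewrite contact_loop_bd ?(sel_bd CP sP) ?xC //;
    first by rewrite (negbTE (xC _ CC)).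
  by rewrite (sel_eq CP sP) //; apply: contraNneq ClN => <-.
rewrite Gco_rcons /=; case: eqP => // /eqP II0.
rewrite mem_rcons in_cons => /orP[/eqP ->|//].
by rewrite twisted_contact_loop_bd ?(sel_bd CP sP) // (negbTE (xC _ ClC))
  mulr0n mul0rn.
Qed.

Lemma contact_span_eq0 c : c \in <<co>>%VS ->
  (forall C, C \in Cco -> c (sel C) = 0) -> c = 0.
Proof.
case/lastP: (Cco) CcoP selP => [|s0 Cl] CP sP.
  by rewrite span_nil memv0 => /eqP.
have [uC _] := CP; move: uC; rewrite rcons_uniq => /andP[ClN us0].
have ClC : Cl \in rcons s0 Cl by rewrite mem_rcons mem_head.
have CC C : C \in s0 -> C \in rcons s0 Cl.
  by move=> Cs0; rewrite mem_rcons in_cons Cs0 orbT.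
have sneq C : C \in s0 -> sel C != sel Cl.
  by move=> Cs0; rewrite (sel_eq CP sP (CC _ Cs0) ClC);
    apply: contraNneq ClN => <-.
have hB := sel_bd CP sP ClC.
have selB C : C \in s0 -> sel C \in bd_edges K.
  by move=> Cs0; apply: (sel_bd CP sP); apply: CC.
have loopE C C' : C \in s0 -> C' \in s0 ->
    loop Cl C (sel C') = (C' == C)%:R.
  move=> Cs0 C's0; rewrite -(sel_eq CP sP (CC _ C's0) (CC _ Cs0)).
  exact: (contact_loop_bd hB (selB _ Cs0) (sneq _ Cs0) (selB _ C's0) (sneq _
    C's0)).
(* [S c] rebuilds the plain-loop part of c from its values at the selected edges, where plain loops
   form a dual basis and the twisted loop vanishes. The coefficient k of the twisted loop is then
   read at [sel Cl]. *)
pose S (c : cochain R V) := \sum_(C <- s0) c (sel C) *: loop Cl C.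
move=> cG; have [k kII cE] : exists2 k : R,
    II = set0 -> k = 0 & c = S c + k *: tloop Cl.
  move: c cG; apply: (@span_ind R _ (fun c : cochain R V => exists2 k : R,
    II = set0 -> k = 0 & c = S c + k *: tloop Cl)).
  - exists 0 => //; rewrite scale0r addr0 /S big1 // => C _.
    by rewrite ffunE scale0r.
  - move=> a u v [ku kuII uE] [kv kvII vE]; exists (a * ku + kv).
      by move=> II0; rewrite kuII // kvII // mulr0 addr0.
    have -> : S (a *: u + v) = a *: S u + S v.
      rewrite /S scaler_sumr -big_split; apply: eq_bigr => C _ /=.
      by rewrite !ffunE scalerDl scalerA.
    by rewrite {1}uE {1}vE scalerDr scalerDl scalerA addrACA.
  move=> u; rewrite Gco_rcons /=.
  have memG : u \in [seq loop Cl C | C <- s0] -> exists2 k : R,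
      II = set0 -> k = 0 & u = S u + k *: tloop Cl.
    case/mapP => C Cs0 ->; exists 0 => //; rewrite scale0r addr0 /S.
    rewrite (bigD1_seq C) //= big1_seq ?addr0.
      by rewrite loopE // eqxx scale1r.
    move=> C' /andP[C'C C's0].
    by rewrite loopE // (negbTE C'C) scale0r.
  case: ifP => [_|/negbT II0]; first exact: memG.
  rewrite mem_rcons in_cons => /orP[/eqP ->|]; last exact: memG.
  exists 1; first by move=> II0'; rewrite II0' eqxx in II0.
  rewrite scale1r /S big1_seq ?add0r // => C /andP[_ Cs0].
  rewrite (twisted_contact_loop_bd II0 hB (selB _ Cs0)).
  by rewrite (negbTE (sneq _ Cs0)) mulr0n mul0rn scale0r.
move=> c0; have Sc0 : S c = 0.
  by rewrite /S big1_seq // => C /andP[_ Cs0]; rewrite c0 ?scale0r //;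
    apply: CC.
move: cE; rewrite Sc0 add0r; have [II0|II0] := eqVneq II set0.
  by rewrite kII // scale0r.
move=> cE; suff k0 : k = 0 by rewrite cE k0 scale0r.
have /ffunP/(_ (sel Cl)) := cE; rewrite c0 // ffunE.
rewrite twisted_contact_loop_bd // eqxx => /esym/eqP.
by rewrite mulf_eq0 pnatr_eq0 orbF => /eqP.
Qed.

(** * Relative coboundaries and hole loops *)

Lemma coboundary_B1 b : b \in C0 -> d b \in B1.
Proof. by move=> bC0; rewrite -coboundaryE_fun memv_img. Qed.

Lemma B1_cocycle b : b \in C0 -> d b \in Z1.
Proof.
move=> bC0; have b0 := rel_cochainsP _ _ _ _ bC0.
apply/rel_cocycles1P; split=> [x xE|f fF]; last first.
  exact: coboundary_coboundary.
have [xE'|xE'] := boolP (x \in edges K); last first.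
  apply: (coboundary_supp oK _ xE') => t tN; apply: b0.
  by rewrite in_setD (negbTE tN) andbF.
have xKc : x \in Kc by move: xE; rewrite in_setD xE' andbT negbK.
have [p [q [_ pq xpq]]] := edge_orient oK xE'.
have b_end v : v \in x -> b [set v] = 0.
  move=> vx; apply: b0; rewrite in_setD (Kc_closed xKc) ?sub1set //.
  by apply/set0Pn; exists v; rewrite set11.
apply/eqP; rewrite xpq coboundary_eq0 -?xpq //.
by rewrite !b_end // xpq ?set21 ?set22.
Qed.

Lemma node_indicator_bd C x : C \in components (bd K) -> x \in bd_edges K ->
  d (ind C) x = 0.
Proof.
move=> CB xB; have xE := bd_edge_edge xB.
have [p [q [_ pq xpq]]] := edge_orient oK xE.
apply/eqP; rewrite xpq coboundary_eq0 -?xpq // !ffunE !inE !cards1.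
have adj v w : v \in x -> w \in x -> [set v] \in C -> [set w] \in C.
  move=> vx wx vC; have [vx' _] := node_adj_bd xB vx.
  have [_ xw] := node_adj_bd xB wx.
  exact: (component_adj CB (component_adj CB vC vx') xw).
have px : p \in x by rewrite xpq set21.
have qx : q \in x by rewrite xpq set22.
by apply/eqP; congr ((_ && _)%:R); apply/idP/idP; apply: adj.
Qed.

Lemma node_indicator_supp C t : C \in components (bd K) ->
  t \notin cells K 0 -> ind C t = 0.
Proof.
move=> CB tN; rewrite ffunE [t \in _](negbTE _) //; apply: contra tN.
rewrite !inE => /andP[/(component_sub CB) + ->].
by rewrite inE => /andP[->].
Qed.

Lemma Cho_component C : C \in Cho -> C \in components (bd K).
Proof. by case: ChoP => _ <-. Qed.

Lemma mem_ho g : g \in ho -> exists2 C, C \in Cho & g = d (ind C).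
Proof.
by case/mapP => C /mem_take CC ->; exists C; rewrite // coboundaryE_fun.
Qed.

Lemma hole_cocycle g : g \in ho -> g \in Z1.
Proof.
case/mem_ho => C /Cho_component CB ->.
apply/rel_cocycles1P; split=> [x xE|f fF]; last first.
  exact: coboundary_coboundary.
have [xE'|xE'] := boolP (x \in edges K); last first.
  apply: (coboundary_supp oK _ xE') => t; exact: node_indicator_supp.
apply: node_indicator_bd CB _; apply: contraNT xE => xB.
exact: internal_rel.
Qed.

Lemma hole_span_bd g x : g \in <<ho>>%VS -> x \in bd_edges K -> g x = 0.
Proof.
move=> gG xB; move: g gG.
apply: (@span_ind R _ (fun g : cochain R V => g x = 0)) => [|a u v u0 v0|u].
- by rewrite ffunE.
- by rewrite !ffunE u0 v0 scaler0 addr0.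
by case/mem_ho => C /Cho_component CB ->; apply: node_indicator_bd.
Qed.

(** The potential may be nonzero on [Kc], so g can still represent a nonzero relative class. *)
Lemma hole_span_exact g : g \in <<ho>>%VS -> exists a, g = d a.
Proof.
move: g; apply: span_ind => [|k u v [a ->] [b ->]|u].
- by exists 0; rewrite linear0.
- by exists (k *: a + b); rewrite linearP.
- by case/mem_ho => C _ ->; exists (ind C).
Qed.

(** The potential is constant on each boundary component. After a global constant and multiples of
    component indicators are subtracted it vanishes on all boundary nodes, in particular on [Kc]. *)
Lemma holes_generate a : (forall t, t \notin cells K 0 -> a t = 0) ->
  (forall e, e \in ET -> e \in bd_edges K -> d a e = 0) ->
  exists g b, [/\ g \in <<ho>>%VS, b \in C0 & d a = g + d b].
Proof.
move=> a0 aET.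
have val_comp C v w : C \in components (bd K) -> [set v] \in C ->
    [set w] \in C -> a [set v] = a [set w].
  by move=> CB vC wC; apply: (component_const aET CB); rewrite inE.
have Kc_node t : t \notin cells K 0 :\: Kc -> t \in cells K 0 ->
    exists v C, [/\ t = [set v], C \in components (bd K) & t \in C].
  rewrite in_setD => + t0; rewrite t0 andbT negbK => tKc.
  have [C CB tC] := component_exists (subsetP Kc_bd _ tKc).
  by move: t0; rewrite inE => /andP[_ /cards1P[v tv]]; exists v, C.
rewrite /Gho; have HC C : C \in components (bd K) = (C \in Cho).
  by case: ChoP => _ ->.
have [uCho _] := ChoP.
case/lastP: Cho HC uCho => [|s0 Cl] HC uCho.
  (* Without boundary components no node lies in [Kc], and a is already a relative cochain. *)
  exists 0, a; rewrite add0r mem0v; split=> //.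
  apply/rel_cochainsP => t tN.
  have [t0|/a0 //] := boolP (t \in cells K 0).
  by have [v [C [_]]] := Kc_node t tN t0; rewrite HC.
rewrite size_rcons /= -cats1 take_size_cat //.
move: uCho; rewrite rcons_uniq => /andP[ClN us0].
(* By [val_comp] the picked node does not matter; 0 is the default for a set without nodes. *)
pose val C : R := if [pick v in nodes C] is Some v then a [set v] else 0.
have valE C v : C \in components (bd K) -> [set v] \in C -> val C = a [set v].
  move=> CB vC; rewrite /val; case: pickP => [w|/(_ v)] /=.
    by rewrite inE => wC; apply: val_comp wC vC.
  by rewrite inE vC.
pose one : cochain R V := [ffun t => (t \in cells K 0)%:R].
have vK v : [set v] \in cells K 0 by rewrite inE (node_cell Kcx) cards1.
have d1 : d one = 0.
  apply/ffunP => x; rewrite [RHS]ffunE.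
  have [xE|xE] := boolP (x \in edges K); last first.
    apply: (coboundary_supp oK _ xE) => t tN.
    by rewrite ffunE (negbTE tN).
  have [p [q [xo _ _]]] := edge_orient oK xE.
  by rewrite (coboundary_edge Kcx oK _ xE xo) !ffunE !vK subrr.
pose g0 : cochain R V := \sum_(C <- s0) (val C - val Cl) *: ind C.
(* The constant [one] has zero coboundary, so normalising the value on the last component Cl to 0
   costs nothing; this is why the indicator of Cl need not be a generator. *)
exists (d g0), (a - val Cl *: one - g0); split.
- rewrite -coboundaryE_fun linear_sum big_seq; apply: memv_suml => C Cs0.
  by rewrite linearZ; apply/memvZ/memv_span/map_f.
- apply/rel_cochainsP => t tN.
  have g0E : g0 t = \sum_(C <- s0) (val C - val Cl) * ind C t.
    by rewrite sum_ffunE; apply: eq_bigr => C _; rewrite ffunE.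
  have -> : (a - val Cl *: one - g0) t = a t - val Cl * one t - g0 t.
    by rewrite !ffunE.
  have sC C : C \in s0 -> C \in components (bd K).
    by move=> Cs0; rewrite HC mem_rcons in_cons Cs0 orbT.
  rewrite g0E; have [t0|tN0] := boolP (t \in cells K 0); last first.
    rewrite a0 // ffunE (negbTE tN0) mulr0 subrr sub0r big1_seq ?oppr0 //.
    move=> C /andP[_ Cs0].
    by rewrite node_indicator_supp ?mulr0 // sC.
  have [v [C0' [tv CB tC]]] := Kc_node t tN t0.
  rewrite [one t]ffunE t0 mulr1 [in a t]tv -(valE C0' v) // -?tv //.
  have indE C : C \in components (bd K) -> ind C t = (C == C0')%:R.
    move=> CB'; rewrite ffunE.
    have -> : (t \in cells C 0) = (t \in C) by rewrite inE tv cards1 andbT.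
    suff -> : (t \in C) = (C == C0') by [].
    by apply/idP/eqP => [tC'|-> //]; apply: component_inj CB' CB tC' tC.
  have [C0s|C0s] := boolP (C0' \in s0).
    rewrite (bigD1_seq C0') //= indE // eqxx mulr1 big1_seq ?addr0 ?subrr //.
    move=> C /andP[CC' Cs0]; rewrite indE ?sC // (negbTE CC') mulr0 //.
  rewrite big1_seq => [|C /andP[_ Cs0]].
    move: CB; rewrite HC mem_rcons in_cons (negbTE C0s) orbF => /eqP ->.
    by rewrite subr0 subrr.
  rewrite indE ?sC //; case: eqP => [CC'|_]; last by rewrite mulr0.
  by rewrite -CC' Cs0 in C0s.
- have dZ m u : d (m *: u) = m *: d u by exact: linearZ.
  by rewrite !linearB /= dZ d1 scaler0 subr0 addrC subrK.
Qed.

(** * Generation by the three families, and directness of their sum *)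

Lemma decomposition z : z \in Z1 -> exists h g c,
  [/\ h \in <<ha>>%VS, g \in <<ho>>%VS, c \in <<co>>%VS
    & z - (h + g + c) \in B1].
Proof.
move=> zZ.
have [b1 b1C0 zb1] := boundary_reduction CcoP selP zZ.
have z1Z : z - d b1 \in Z1 by apply: memvB => //; apply: B1_cocycle.
have subE (u v : cochain R V) x : (u - v) x = u x - v x by rewrite !ffunE.
have z1S x : x \in bd_edges K -> x \notin sels -> (z - d b1) x = 0.
  by move=> xB xS; rewrite subE zb1 // subrr.
have [c cG z2B] := contacts_generate z1Z z1S.
(* The potential takes over the values on [ET]. The remainder being zero on the boundary, so is
   [d a], which [holes_generate] can then split. *)
have [a [a0 aET]] := ET_potential (z - d b1 - c).
have aETB e : e \in ET -> e \in bd_edges K -> d a e = 0.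
  by move=> eET eB; rewrite aET // z2B.
have aB := coboundary_bd_eq0 aETB.
have [g [b2 [gG b2C0 aE]]] := holes_generate a0 aETB.
have aZ : d a \in Z1.
  rewrite aE; apply: memvD; last exact: B1_cocycle.
  exact: (span_cocycle hole_cocycle).
pose h := z - d b1 - c - d a.
have hG : h \in <<ha>>%VS.
  apply: (handles_generate esh).
  - by do 2?apply: memvB => //; apply: (span_cocycle contact_cocycle).
  - by move=> x xB; rewrite /h subE z2B // aB // subrr.
  - by move=> x xET; rewrite /h subE aET // subrr.
exists h, g, c; split=> //.
have -> : z - (h + g + c) = d b1 + d b2.
  rewrite /h aE; apply/ffunP => x; move: (d b1) (d b2) => u v.
  by rewrite !ffunE; ring.
by apply: memvD; apply: coboundary_B1.
Qed.

(** The conclusion treats the families differently: h and c vanish as cochains, but g only as a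
    class. For instance, the indicator of a boundary component disjoint from [Kc] is a relative
    cochain, so its hole loop lies in [B1]. *)
Lemma directness h g c :
  h \in <<ha>>%VS -> g \in <<ho>>%VS -> c \in <<co>>%VS -> h + g + c \in B1 ->
  [/\ h = 0, g \in B1 & c = 0].
Proof.
move=> hG gG cG /memv_imgP[b bC0]; rewrite coboundaryE_fun => E.
have hS x := handle_span_supp esh hG (x := x).
have cB x : x \in bd_edges K -> c x = d b x.
  move=> xB; rewrite -E.
  have -> : (h + g + c) x = h x + g x + c x by rewrite !ffunE.
  by rewrite hS ?xB // (hole_span_bd gG xB) !add0r.
have c0 : c = 0.
  apply: contact_span_eq0 => // C CC; rewrite cB;
    last exact: (sel_bd CcoP selP CC).
  apply: (boundary_independence CcoP selP bC0 CC) => x xB xS.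
  by rewrite -cB // (contact_span_bd cG).
have [a gE] := hole_span_exact gG.
have hE : h = d (b - a) by rewrite linearB /= -E -gE c0 addr0 addrK.
have h0 : h = 0.
  have hZ : h \in Z1.
    exact: (handle_span_cocycle esh hG).
  have [hsupp _] := rel_cocycles1P _ hZ.
  have const := ET_const (a := b - a).
  apply/ffunP => x; rewrite [RHS]ffunE.
  have [xE|xE] := boolP (x \in edges K); last first.
    by apply: hsupp; rewrite in_setD (negbTE xE) andbF.
  have [p [q [xo _ _]]] := edge_orient oK xE.
  rewrite hE (coboundary_edge Kcx oK _ xE xo) (const _ p q) ?subrr //.
  by move=> e eET; rewrite -hE hS // eET orbT.
split=> //; rewrite -[g](addr0) -[g](add0r) -[X in X + g]h0 -[X in _ + X]c0 E.
exact: coboundary_B1.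
Qed.

End Decomposition.

End GlobalLoops.

(** * The subcomplex induced on a closed part of the boundary *)

Section Induced.
Import boot.fintype boot.finset.
Variables (R : realType) (V : finType) (K : {set {set V}}).
Variables (phi : 'rV[R]_#|V| -> 'rV[R]_3) (X : set 'rV[R]_3).

Lemma induced_on_sub L : induced_on phi L X \subset L.
Proof. by apply/subsetP => s; rewrite inE => /andP[]. Qed.

Lemma closed_simplexS (s t : {set V}) :
  t \subset s -> (closed_simplex R t `<=` closed_simplex R s)%classic.
Proof.
move=> ts x [x0 x1 xt]; split=> // v vs; apply: xt.
by apply: contra vs; apply: (subsetP ts).
Qed.

(** The closed simplex of a face lies in that of the simplex, so the condition on images passes to
    faces. This turns the geometric definition of [Kc] into the closure property used above. *)
Lemma induced_on_closed : surface_complex K ->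
  forall s t : {set V}, s \in induced_on phi (bd K) X -> t \subset s -> t !=
    set0 ->
  t \in induced_on phi (bd K) X.
Proof.
move=> KS s t; rewrite inE => /andP[sB /asboolP sX] ts t0.
rewrite inE; apply/andP; split.
  move: sB; rewrite !inE => /andP[sK /existsP[e /andP[eB se]]].
  rewrite (face_closed KS sK ts t0); apply/existsP; exists e.
  by rewrite eB (subset_trans ts).
apply/asboolP => y [x xt <-]; apply: sX; exists x => //.
exact: closed_simplexS xt.
Qed.

End Induced.

(** The isomorphism is addition of classes, so the three spans form an internal direct sum in
    cohomology. The edges [es_ha] and [es_co] are separate because the handles and contacts
    algorithms each select their own e*. *)
Theorem lemma10 (R : realType) (V : finType) (K : {set {set V}})
    (phi : 'rV[R]_#|V| -> 'rV[R]_3) (Gamma dGammac : set 'rV[R]_3)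
    (o : {set V} -> seq V)
    (ET : {set {set V}}) (Tt : {set {set {set V}}})
    (f1 f2 : {set V} -> {set V}) (es_ha es_co : {set V})
    (Cho Cco : seq {set {set V}}) (sel : {set {set V}} -> {set V}) :
  triangulates K phi Gamma ->
  closed dGammac -> (dGammac `<=` surface_boundary K phi)%classic ->
  orientation K o ->
  handles_tree K ET -> handles_dual_tree K ET Tt -> face_labels K f1 f2 ->
  (EMII R K o ET Tt f1 f2 != finset.set0 ->
     es_ha \in EMII R K o ET Tt f1 f2 /\ es_co \in EMII R K o ET Tt f1 f2) ->
  let Kc := induced_on phi (bd K) dGammac in
  numbering (bd K) Cho ->
  numbering (bd K :\: Kc)%SET Cco -> contact_edges Cco sel ->
  let ha := Gha R K o ET Tt f1 f2 es_ha in
  let ho := Gho R K o Cho in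
  let co := Gco R K o ET Tt f1 f2 Cco sel es_co in
  [/\ {subset ha <= rel_cocycles1 R K Kc o},
      {subset ho <= rel_cocycles1 R K Kc o},
      {subset co <= rel_cocycles1 R K Kc o}
    & exists2 f : 'Hom((subvs_of (span_classes K Kc o ha) *
                        subvs_of (span_classes K Kc o ho) *
                        subvs_of (span_classes K Kc o co))%type,
                       subvs_of (rel_H1 R K Kc o)),
        bijective f
      & forall x y z,
          vsval (f (x, y, z)) = vsval x + vsval y + vsval z].
Proof.
move=> [KS _ _ _] _ _ oK ETP [T0 T0P TtE] labels esP Kc ChoP CcoP selP ha ho
  co.
have Kc_bd : Kc \subset bd K := induced_on_sub phi dGammac (bd K).
have Kc_closed := @induced_on_closed _ _ _ phi dGammac KS.
have [omega [omega_sq omega_tree]] := omega_exists R oK T0P.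
have esh : EMII R K o ET Tt f1 f2 != finset.set0 ->
    es_ha \in EMII R K o ET Tt f1 f2 by case/esP.
have haZ h : h \in <<ha>>%VS -> h \in rel_cocycles1 R K Kc o.
  exact: (handle_span_cocycle KS oK T0P TtE omega_sq omega_tree labels Kc_bd
    esh).
have hoZ := @hole_cocycle R _ _ _ KS oK _ Kc_bd _ ChoP.
have coZ := contact_cocycle KS oK T0P TtE omega_sq omega_tree labels Kc_bd
  esP CcoP selP.
have dec := decomposition KS oK T0P TtE omega_sq omega_tree labels Kc_bd
  ETP Kc_closed esP ChoP CcoP selP.
have dir := directness KS oK T0P TtE omega_sq omega_tree labels Kc_bd
  ETP Kc_closed esP ChoP CcoP selP.
split; [by move=> h hG; apply/haZ/memv_span | exact: hoZ | exact: coZ |].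
have spanE G : span_classes K Kc o G = (cohom_class R K Kc o @: <<G>>)%VS.
  by rewrite limg_span.
have ker v : (cohom_class R K Kc o v == 0) = (v \in rel_coboundaries1 R K Kc
  o).
  exact: qcls_ker.
(* Elements of the three spans lift to cochains in the spans of the loops. The goals then follow
   from the cocycle lemmas, from [dec] for surjectivity and from [dir] for injectivity. *)
rewrite !spanE; apply: sum_hom_exists.
- move=> _ _ _ /memv_imgP[h hG ->] /memv_imgP[g gG ->] /memv_imgP[c cG ->].
  rewrite -!GRing.linearD memv_img //; apply: memvD;
    last exact: (span_cocycle coZ).
  by apply: memvD; [exact: haZ | exact: (span_cocycle hoZ)].
- move=> _ /memv_imgP[z zZ ->]; have [h [g [c [hG gG cG zB]]]] := dec z zZ.
  exists (cohom_class R K Kc o h), (cohom_class R K Kc o g),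
    (cohom_class R K Kc o c).
  split; rewrite ?memv_img // -!GRing.linearD; apply/eqP.
  by rewrite -GRing.subr_eq0 -GRing.linearB ker.
- move=> _ _ _ /memv_imgP[h hG ->] /memv_imgP[g gG ->] /memv_imgP[c cG ->].
  rewrite -!GRing.linearD => /eqP; rewrite ker => B.
  have [h0 gB c0] := dir h g c hG gG cG B.
  by rewrite h0 c0 GRing.linear0; split=> //; apply/eqP; rewrite ker.
Qed.
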